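(* Let $\{P_i\}_{i=1}^m$ $(P_i\in\mathrm{Sym}(\mathbb{R}^{2l}_s))$ be a Clifford system of signature $(m,r)$ on $\mathbb{R}^{2l}_s$, where $s\le 2l-1$, satisfying $m\equiv 0\pmod 4$, $r\equiv 0\pmod 2$ and $l>m$. Then for every $c\in \mathrm{W}_{\mathrm{RN}}(f)\cap(-1,\infty)$, each connected component of $M_c=f^{-1}(c)$ is inhomogeneous, i.e. not homogeneous.
   Context: For $0\le s\le n$, $\mathbb{R}^n_s$ denotes $\mathbb{R}^n$ with the pseudo-inner product $\langle u,v\rangle={}^t u\,J_{s,n-s}\,v$, where $J_{i,j}:=(-E_i)\oplus E_j$ ($J_{0,j}=E_j$, $J_{i,0}=-E_i$), and $S^{n-1}_s:=\{x\in\mathbb{R}^n_s\mid\langle x,x\rangle=1\}$ is the pseudo-sphere. $\mathrm{Sym}(\mathbb{R}^n_s)$ is the set of linear endomorphisms $Q$ with $\langle Qu,v\rangle=\langle u,Qv\rangle$ for all $u,v$. For a positive integer $l$, $s\in\{0,\ldots,2l\}$, an integer $m>1$ and $r\in\{0,\ldots,m\}$, a Clifford system of signature $(m,r)$ on $\mathbb{R}^{2l}_s$ is a family $\{P_i\}_{i=1}^m$ with $P_i\in\mathrm{Sym}(\mathbb{R}^{2l}_s)$ and $P_iP_j+P_jP_i=2\eta_{ij}I$ for all $i,j$, where $(\eta_{ij})=J_{r,m-r}$. Define $F(x):=\langle x,x\rangle^2-2\sum_{j=1}^m\eta_{jj}\langle P_jx,x\rangle^2$ on $\mathbb{R}^{2l}_s$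 and $f:=F|_{S^{2l-1}_s}$. Put $\mathrm{W}_{\mathrm{RN}}(f):=f(S^{2l-1}_s)\setminus\{-1,1\}$ and $M_c:=f^{-1}(c)\subset S^{2l-1}_s$ for $c\in\mathrm{W}_{\mathrm{RN}}(f)$. Each connected component of $M_c$ is a non-degenerate hypersurface, called an isoparametric hypersurface of OT-FKM-type. A connected submanifold $L\subset S^{2l-1}_s$ is homogeneous if some Lie subgroup of the isometry group of $S^{2l-1}_s$, which is $O(s,2l-s)=\{A\mid{}^tAJ_{s,2l-s}A=J_{s,2l-s}\}$ acting linearly, acts on $L$ (i.e. preserves $L$) transitively. *)

(* Defs.v *)
From HB Require Import structures.
From mathcomp Require Import all_boot all_order all_algebra.
From mathcomp Require Import all_classical all_reals all_analysis.

Set Implicit Arguments.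
Unset Strict Implicit.
Unset Printing Implicit Defensive.

Import Order.TTheory GRing.Theory Num.Theory.
Import numFieldNormedType.Exports.

Local Open Scope classical_set_scope.
Local Open Scope ring_scope.

Section Defs.
Variable R : realType.

(* [Jmx i n] is J_{i,n-i} = (-E_i) (+) E_{n-i}, for i <= n. *)
Definition Jmx (i n : nat) : 'M[R]_n :=
  diag_mx (\row_(k < n) (if (k < i)%N then -1 else 1)).

Definition pinner n (s : nat) (u v : 'cV[R]_n) : R :=
  (u^T *m Jmx s n *m v) 0 0.

Definition psphere (n s : nat) : set 'cV[R]_n := [set x | pinner s x x = 1].

Definition pseudo_sym n (s : nat) (Q : 'M[R]_n) : Prop :=
  forall u v : 'cV[R]_n, pinner s (Q *m u) v = pinner s u (Q *m v).

Definition clifford_system n (s m r : nat) (P : 'I_m -> 'M[R]_n) : Prop :=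
  (forall i, pseudo_sym s (P i)) /\
  (forall i j, P i *m P j + P j *m P i = (2 * Jmx r m i j) *: 1%:M).

Definition fkmF n (s m r : nat) (P : 'I_m -> 'M[R]_n) (x : 'cV[R]_n) : R :=
  pinner s x x ^+ 2
  - 2 * \sum_(j < m) Jmx r m j j * pinner s (P j *m x) x ^+ 2.

Definition W_RN n (s m r : nat) (P : 'I_m -> 'M[R]_n) : set R :=
  (fkmF s r P @` @psphere n s) `\` [set -1; 1].

Definition level n (s m r : nat) (P : 'I_m -> 'M[R]_n) (c : R) : set 'cV[R]_n :=
  [set x | @psphere n s x /\ fkmF s r P x = c].

Definition is_component (T : topologicalType) (M L : set T) : Prop :=
  exists2 x, M x & L = connected_component M x.

Definition pseudo_orthogonal (n s : nat) : set 'M[R]_n :=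
  [set A | A^T *m Jmx s n *m A = Jmx s n].

(* [Ck k U f]: f is of class C^k on the open set U of a finite-dimensional
   space, i.e. f is differentiable on U and all its directional derivatives
   are of class C^(k-1) there. *)
Fixpoint Ck (V W : normedModType R) (k : nat) (U : set V) (f : V -> W) : Prop :=
  match k with
  | 0%N => forall x, U x -> {for x, continuous f}
  | k'.+1 => (forall x, U x -> differentiable f x) /\
             (forall v, Ck k' U (fun x => 'D_v f x))
  end.

Definition smooth_on (V W : normedModType R) (U : set V) (f : V -> W) : Prop :=
  forall k, Ck k U f.

(* Smoothness of a map g from the open set D into the manifold whose local
   parametrizations are the [par i : dom i -> 'M_n]; this manifold carries its
   own topology, not the one induced by 'M_n, so that openness of the preimage
   of a chart has to be required. *)
Definition smooth_into n k (dom : nat -> set 'rV[R]_k)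
    (par : nat -> 'rV[R]_k -> 'M[R]_n)
    (V : normedModType R) (D : set V) (g : V -> 'M[R]_n) : Prop :=
  forall i, let Di := D `&` g @^-1` (par i @` dom i) in
    open Di /\
    exists h : V -> 'rV[R]_k,
      smooth_on Di h /\ (forall x, Di x -> dom i (h x) /\ par i (h x) = g x).

(* Immersed (not necessarily closed) k-dimensional submanifold structure on H,
   given by a countable atlas: second countability is what prevents an
   arbitrary subgroup from being a 0-dimensional Lie subgroup.  The Hausdorff
   property is automatic, H being mapped continuously and injectively to
   'M_n. *)
Definition immersed_atlas n k (H : set 'M[R]_n) (dom : nat -> set 'rV[R]_k)
    (par : nat -> 'rV[R]_k -> 'M[R]_n) : Prop :=
  [/\ forall i, open (dom i),
      H = \bigcup_i (par i @` dom i),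
      forall i, {in dom i &, injective (par i)},
      forall i, smooth_on (dom i) (par i) /\
                (forall x v, dom i x -> 'D_v (par i) x = 0 -> v = 0) &
      forall i, smooth_into dom par (dom i) (par i)].

(* As the isometry group is an embedded submanifold of 'M_n, immersions into
   it are the immersions into 'M_n with values in it. *)
Definition lie_subgroup n (s : nat) (H : set 'M[R]_n) : Prop :=
  [/\ H `<=` @pseudo_orthogonal n s,
      H 1%:M,
      forall A B, H A -> H B -> H (A *m B),
      forall A, H A -> H (invmx A) &
      exists k (dom : nat -> set 'rV[R]_k) (par : nat -> 'rV[R]_k -> 'M[R]_n),
        [/\ immersed_atlas H dom par,
            forall i j, smooth_into dom par (dom i `*` dom j)
                          (fun u : 'rV[R]_k * 'rV[R]_k => par i u.1 *m par j u.2) &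
            forall i, smooth_into dom par (dom i) (fun u => invmx (par i u))]].

Definition homogeneous n (s : nat) (L : set 'cV[R]_n) : Prop :=
  exists H : set 'M[R]_n,
    [/\ lie_subgroup s H,
        forall A x, H A -> L x -> L (A *m x) &
        forall x y, L x -> L y -> exists2 A, H A & A *m x = y].

End Defs.

(* Main.v *)
Require Import Defs.
From HB Require Import structures.
From mathcomp Require Import all_boot all_order all_algebra.
From mathcomp Require Import ring lra zify complex.
From mathcomp Require Import all_classical all_reals all_analysis.
Import Order.TTheory GRing.Theory Num.Theory.
Import numFieldNormedType.Exports.
Local Open Scope classical_set_scope.
Local Open Scope ring_scope.

Set Implicit Arguments.
Unset Strict Implicit.
Unset Printing Implicit Defensive.

(** Write [q x] for the pseudo-norm [<x,x>], [p_j x = <P_j x, x>],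
    [g x = sum_j eta_j (p_j x)^2] and [M_x = sum_j eta_j p_j(x) P_j]. On the
    pseudo-sphere the level set of [c] is [g = g0] with [g0 = (1 - c) / 2],
    which is neither 0 nor 1, and its normal plane at [x], taken in the cone, is
    spanned by [x] and [M_x x].

    Since 4 divides [m] and [r] is even, the product [S] of all the [P_j] is
    symmetric, squares to 1 and anticommutes with every [P_j]. The function
    [f x = <S x, x>] is the obstruction to homogeneity: a transitive group
    would force it to be constant on [L], and it is not.

    Why [f] would be constant. Let [A] be an isometry preserving [L]. Normal
    directions go to normal directions, so the pulled-back field
    [A^-1 (M_{Ax} (A x))] is either [M_x x] or the reflected normal
    [2 g0 x - M_x x] ([normal_dichotomy]), and the same alternative holds all
    over the connected set [L] ([normal_constant]). In the first case
    [g (A y) = g y] for all [y], because the normal planes along [L] sweep out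
    a neighbourhood of a point of [L] and [g] is a polynomial ([normal_csum]).
    The quartic form [g] determines the span of the [P_j] ([in_span_other]):
    contracting its polarization with a symmetric endomorphism [Q] gives an
    operator [T] for which the [P_j] are eigenvectors with eigenvalue
    [2 l + 4 - 2 m], while off their span [T] is twice the sum of [m] commuting
    involutions [Q |-> eta_j P_j Q P_j], so that its eigenvalues lie between
    [-2 m] and [2 m]. The eigenvalue [-2 m] characterises the endomorphisms
    that anticommute with all the [P_j], which makes [S] anticommute with the
    conjugated system too. The eigenvalue [2 l + 4 - 2 m] is at least [2 m],
    because [l > m] and a Clifford module over the complex numbers has
    dimension divisible by [2^(m/2)] ([clifford_dim]), and in the borderline case [S] separates the
    two sorts of eigenvectors. Hence conjugation by [A] preserves the span of
    the [P_j], so it maps [S] to [S] or [- S] ([pscalar_unique]) and preserves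
    [f^2]. The composition of two reflecting isometries is of the first kind,
    so under a transitive group [f^2] takes at most two values on [L]; as [L]
    is connected, [f^2] and then [f] are constant.

    Why [f] is not constant ([pscalar_nonconstant]). If it were, its gradient
    [S x] would be normal along [L], that is [S x = a (x - M_x x)] for a
    constant [a] with [a^2 (1 - g0) = 1]. Differentiating this identity gives
    [S v = a (v - M_x v)] for all [v] orthogonal to [x] and to the [P_j x], so
    that [S + a M_x - a] has rank at most [m]. But [(S + a M_x) / a] is an
    involution without trace, so this rank is [l > m].

    The differentiations need enough curves in [L]. They are explicit: a point
    [x + t v] is pushed along its normal plane back to the level set, which
    only takes the solution of a quadratic equation ([normal_correction],
    [level_curve]). *)

(** * The pseudo-inner product *)

Section PseudoInner.
Variables (R : realType) (n s : nat).
Implicit Types (u v w x y : 'cV[R]_n) (Q : 'M[R]_n).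
Local Notation J := (Jmx R s n).

Lemma trJ : J^T = J.
Proof. exact: tr_diag_mx. Qed.

Lemma Jmx_sqr i : Jmx R s n i i * Jmx R s n i i = 1.
Proof. by rewrite /Jmx !mxE eqxx mulr1n; case: ifP => _; rewrite ?mulr1 // mulrNN mulr1. Qed.

Lemma Jmx_off i j : i != j -> Jmx R s n i j = 0.
Proof. by move=> ij; rewrite /Jmx !mxE (negbTE ij) mulr0n. Qed.

Lemma mulJJ : J *m J = 1%:M.
Proof.
apply/matrixP=> i j; rewrite /Jmx mul_diag_mx !mxE.
case: (i == j); rewrite ?mulr0n ?mulr0 // !mulr1n.
by case: ifP => _; rewrite ?mulr1 // mulrNN mulr1.
Qed.

Lemma pinnerE u v : pinner s u v = \sum_i J i i * (u i 0 * v i 0).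
Proof.
rewrite /pinner /Jmx -mulmxA mul_diag_mx mxE; apply: eq_bigr => i _.
by rewrite !mxE eqxx mulr1n mulrCA.
Qed.

Lemma pinnerC u v : pinner s u v = pinner s v u.
Proof. by rewrite !pinnerE; apply: eq_bigr => i _; rewrite [u i 0 * _]mulrC. Qed.

Lemma pinnerDl u v w : pinner s (u + v) w = pinner s u w + pinner s v w.
Proof. by rewrite /pinner linearD /= !mulmxDl mxE. Qed.
Lemma pinnerDr u v w : pinner s u (v + w) = pinner s u v + pinner s u w.
Proof. by rewrite /pinner mulmxDr mxE. Qed.
Lemma pinnerZl a u w : pinner s (a *: u) w = a * pinner s u w.
Proof. by rewrite /pinner linearZ /= -!scalemxAl mxE. Qed.
Lemma pinnerZr a u w : pinner s u (a *: w) = a * pinner s u w.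
Proof. by rewrite /pinner -!scalemxAr mxE. Qed.
Lemma pinnerNl u w : pinner s (- u) w = - pinner s u w.
Proof. by rewrite -scaleN1r pinnerZl mulN1r. Qed.
Lemma pinnerNr u w : pinner s u (- w) = - pinner s u w.
Proof. by rewrite -scaleN1r pinnerZr mulN1r. Qed.
Lemma pinner_suml k (F : 'I_k -> 'cV[R]_n) w :
  pinner s (\sum_j F j) w = \sum_j pinner s (F j) w.
Proof.
elim/big_rec2: _ => [|j a u _ <-]; last by rewrite pinnerDl.
by rewrite -(scale0r 0) pinnerZl mul0r.
Qed.

Definition pinner_lin :=
  (pinnerDl, pinnerDr, pinnerNl, pinnerNr, pinnerZl, pinnerZr).

Lemma pinner_nondeg u : (forall v, pinner s u v = 0) -> u = 0.
Proof.
move=> h; apply/colP => i; rewrite mxE.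
have delE j : (delta_mx i 0 : 'cV[R]_n) j 0 = (j == i)%:R by rewrite mxE andbT.
have := h (delta_mx i 0); rewrite pinnerE (bigD1 i) //= big1 => [|j ji].
  rewrite addr0 delE eqxx mulr1 => /(congr1 ( *%R (J i i))).
  by rewrite mulrA Jmx_sqr mul1r mulr0.
by rewrite delE (negbTE ji) !mulr0.
Qed.

(** The adjoint of [Q] with respect to the pseudo-inner product. *)
Definition padj Q := J *m Q^T *m J.

Lemma pinner_adj Q u v : pinner s (Q *m u) v = pinner s u (padj Q *m v).
Proof. by rewrite /pinner /padj trmx_mul !mulmxA -(mulmxA u^T J J) mulJJ mulmx1. Qed.

Lemma padjM Q1 Q2 : padj (Q1 *m Q2) = padj Q2 *m padj Q1.
Proof. by rewrite /padj trmx_mul !mulmxA -(mulmxA _ J J) mulJJ mulmx1. Qed.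

Lemma padj1 : padj 1%:M = 1%:M.
Proof. by rewrite /padj trmx1 mulmx1 mulJJ. Qed.

Lemma pseudo_symP Q : pseudo_sym s Q <-> padj Q = Q.
Proof.
split=> [h|h u v]; last by rewrite pinner_adj h.
apply/matrixP=> i j.
have : padj Q *m delta_mx j 0 = Q *m delta_mx j 0 :> 'cV_n.
  apply/eqP; rewrite -subr_eq0; apply/eqP; apply: pinner_nondeg => v.
  rewrite pinnerDl pinnerNl [pinner s (padj Q *m _) v]pinnerC -pinner_adj h.
  by rewrite [pinner s v _]pinnerC subrr.
by rewrite -!colE => /colP /(_ i); rewrite !mxE.
Qed.

End PseudoInner.

(** * Clifford systems and the normal plane *)

Section Clifford.
Variables (R : realType) (n s m r : nat) (P : 'I_m -> 'M[R]_n).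
Implicit Types (u v w x y : 'cV[R]_n) (j k : 'I_m).

Definition csign (k : 'I_m) : R := Jmx R r m k k.
Local Notation eta := csign.

Definition cquad k x : R := pinner s (P k *m x) x.

Definition csum x : R := \sum_k eta k * cquad k x ^+ 2.

Definition cmx x : 'M[R]_n := \sum_k (eta k * cquad k x) *: P k.

(** A quarter of the gradient of [csum] at [x]. *)
Definition cnormal x : 'cV[R]_n := cmx x *m x.

Lemma fkmFE x : fkmF s r P x = pinner s x x ^+ 2 - 2 * csum x.
Proof. by []. Qed.

Lemma csign_sqr k : eta k * eta k = 1. Proof. exact: Jmx_sqr. Qed.

Hypothesis hP : clifford_system s r P.

Lemma cliff_sym k u v : pinner s (P k *m u) v = pinner s u (P k *m v).
Proof. by case: hP => h _; apply: h. Qed.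

Lemma cliff_padj k : padj s (P k) = P k.
Proof. by apply/pseudo_symP; case: hP. Qed.

Lemma cliff_sqr k : P k *m P k = (eta k)%:M.
Proof.
have := hP.2 k k; rewrite -mulr2n -scaler_nat => /(congr1 (fun Q => 2^-1 *: Q)).
rewrite !scalerA mulVf ?pnatr_eq0 // scale1r => ->.
by rewrite mulrA mulVf ?pnatr_eq0 // mul1r scalemx1.
Qed.

Lemma cliff_anti j k : j != k -> P j *m P k = - (P k *m P j).
Proof.
move=> jk; have := hP.2 j k; rewrite Jmx_off // mulr0 scale0r => /eqP.
by rewrite addr_eq0 => /eqP.
Qed.

(** The Clifford relations in coordinate-free form. *)
Lemma cliff_lin (a b : 'I_m -> R) :
  (\sum_i a i *: P i) *m (\sum_j b j *: P j)
  + (\sum_j b j *: P j) *m (\sum_i a i *: P i)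
  = (2 * \sum_k eta k * (a k * b k))%:M.
Proof.
have mulE (c d : 'I_m -> R) : (\sum_i c i *: P i) *m (\sum_j d j *: P j)
    = \sum_i \sum_j (c i * d j) *: (P i *m P j).
  rewrite mulmx_suml; apply: eq_bigr => i _; rewrite mulmx_sumr.
  by apply: eq_bigr => j _; rewrite -scalemxAr -scalemxAl scalerA mulrC.
rewrite !mulE [X in _ + X]exchange_big -big_split /= -scalemx1 mulr_sumr scaler_suml.
apply: eq_bigr => i _; rewrite -big_split /= (bigD1 i) //= big1 => [|j ji].
  by rewrite addr0 mulrC -scalerDr hP.2 scalerA; congr (_ *: _); rewrite /csign; ring.
by rewrite [b j * _]mulrC -scalerDr hP.2 Jmx_off 1?eq_sym // mulr0 scale0r scaler0.
Qed.

Lemma cmx_sqr x : cmx x *m cmx x = (csum x)%:M.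
Proof.
have := cliff_lin (fun k => eta k * cquad k x) (fun k => eta k * cquad k x).
rewrite -/(cmx x) -mulr2n -scaler_nat => /(congr1 (fun Q => 2^-1 *: Q)).
rewrite !scalerA mulVf ?pnatr_eq0 // scale1r => ->.
rewrite scale_scalar_mx mulrA mulVf ?pnatr_eq0 // mul1r /csum; congr (_%:M).
apply: eq_bigr => k _; have := csign_sqr k; set e := eta k => ee.
by rewrite -[RHS]mul1r -{1}ee; ring.
Qed.

Lemma cmx_anti k x : P k *m cmx x + cmx x *m P k = (2 * cquad k x)%:M.
Proof.
have := cliff_lin (fun i => (i == k)%:R) (fun k => eta k * cquad k x).
rewrite -/(cmx x) (bigD1 k) //= eqxx scale1r big1 ?addr0 => [->|i /negbTE ->]; last first.
  by rewrite scale0r.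
congr (2 * _)%:M; rewrite (bigD1 k) //= eqxx mul1r big1 ?addr0 => [|i /negbTE ->].
  by rewrite mulrA csign_sqr mul1r.
by rewrite mul0r mulr0.
Qed.

Lemma cmx_sym x u v : pinner s (cmx x *m u) v = pinner s u (cmx x *m v).
Proof.
rewrite !mulmx_suml pinner_suml [RHS]pinnerC pinner_suml; apply: eq_bigr => k _.
by rewrite -!scalemxAl !pinner_lin cliff_sym [pinner s _ u]pinnerC.
Qed.

Lemma pinner_cnormal x : pinner s (cnormal x) x = csum x.
Proof.
rewrite /cnormal mulmx_suml pinner_suml; apply: eq_bigr => k _.
by rewrite -scalemxAl pinner_lin -/(cquad k x) expr2 mulrA.
Qed.

Lemma pinner_cnormal2 x : pinner s (cnormal x) (cnormal x) = csum x * pinner s x x.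
Proof. by rewrite -cmx_sym mulmxA cmx_sqr mul_scalar_mx pinner_lin. Qed.

(** The operators [P k] and [cmx x] do not commute, but only the symmetric part
    of their product enters here, and it is scalar. *)
Lemma pinner_P_cnormal k x : pinner s (P k *m x) (cnormal x) = cquad k x * pinner s x x.
Proof.
have : pinner s ((P k *m cmx x + cmx x *m P k) *m x) x
  = 2 * (cquad k x * pinner s x x).
  by rewrite cmx_anti mul_scalar_mx pinner_lin mulrA.
rewrite mulmxDl pinnerDl -!mulmxA -/(cnormal x) cliff_sym cmx_sym.
rewrite [pinner s _ (P k *m x)]pinnerC => h; lra.
Qed.

Lemma cquad_cnormal k x : cquad k (cnormal x) = csum x * cquad k x.
Proof.
have mpm : cmx x *m P k *m cmx x = (2 * cquad k x) *: cmx x - csum x *: P k.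
  have -> : cmx x *m P k = (2 * cquad k x)%:M - P k *m cmx x.
    by rewrite -(cmx_anti k x) addrC addKr.
  by rewrite mulmxBl mul_scalar_mx -mulmxA cmx_sqr mul_mx_scalar.
rewrite /cquad {2}/cnormal -cmx_sym !mulmxA mpm mulmxBl -!scalemxAl !pinner_lin.
by rewrite -/(cnormal x) pinner_cnormal -/(cquad k x); ring.
Qed.

(** The common factor by which all the [cquad k] change when [x] moves to
    [al *: x + be *: cnormal x]; this proportionality is what makes the normal
    planes of the level sets explicit. *)
Definition plane_scale (al be : R) x : R :=
  al ^+ 2 + 2 * al * be * pinner s x x + be ^+ 2 * csum x.

Lemma pinner_plane al be x :
  pinner s (al *: x + be *: cnormal x) (al *: x + be *: cnormal x)
  = al ^+ 2 * pinner s x x + 2 * al * be * csum x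
    + be ^+ 2 * (csum x * pinner s x x).
Proof.
rewrite !pinner_lin pinner_cnormal2 [pinner s x (cnormal x)]pinnerC pinner_cnormal.
by ring.
Qed.

Lemma cquad_plane k al be x :
  cquad k (al *: x + be *: cnormal x) = plane_scale al be x * cquad k x.
Proof.
rewrite {1}/cquad mulmxDr -!scalemxAr !pinner_lin -!/(cquad _ _).
rewrite pinner_P_cnormal cquad_cnormal cliff_sym [pinner s _ (P k *m x)]pinnerC.
by rewrite pinner_P_cnormal /plane_scale; ring.
Qed.

Lemma cmx_plane al be x :
  cmx (al *: x + be *: cnormal x) = plane_scale al be x *: cmx x.
Proof.
rewrite /cmx scaler_sumr; apply: eq_bigr => k _.
by rewrite cquad_plane scalerA mulrCA.
Qed.

Lemma csum_plane al be x :
  csum (al *: x + be *: cnormal x) = plane_scale al be x ^+ 2 * csum x.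
Proof.
rewrite /csum mulr_sumr; apply: eq_bigr => k _.
by rewrite cquad_plane; ring.
Qed.

Lemma cnormal_plane al be x :
  cnormal (al *: x + be *: cnormal x)
  = plane_scale al be x *: (al *: cnormal x + (be * csum x) *: x).
Proof.
rewrite {1}/cnormal cmx_plane -scalemxAl mulmxDr -!scalemxAr.
by rewrite {2}/cnormal mulmxA cmx_sqr mul_scalar_mx scalerA.
Qed.

Lemma cquadZ k a x : cquad k (a *: x) = a ^+ 2 * cquad k x.
Proof. by rewrite /cquad -scalemxAr !pinner_lin; ring. Qed.

Lemma csumZ a x : csum (a *: x) = a ^+ 4 * csum x.
Proof.
by rewrite /csum mulr_sumr; apply: eq_bigr => k _; rewrite cquadZ; ring.
Qed.

Lemma cmxZ a x : cmx (a *: x) = a ^+ 2 *: cmx x.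
Proof.
by rewrite /cmx scaler_sumr; apply: eq_bigr => k _; rewrite cquadZ scalerA mulrCA.
Qed.

Lemma cnormalZ a x : cnormal (a *: x) = a ^+ 3 *: cnormal x.
Proof. by rewrite /cnormal cmxZ -scalemxAl -scalemxAr scalerA -exprSr. Qed.

(** As [csum] is quartic along a line, its fourth difference along the line
    recovers its value at the direction. *)
Lemma csum_diff4 x v t :
  24 * t ^+ 4 * csum v =
    csum (x + (4 * t) *: v) - 4 * csum (x + (3 * t) *: v)
    + 6 * csum (x + (2 * t) *: v) - 4 * csum (x + t *: v) + csum x.
Proof.
rewrite /csum !mulr_sumr -!sumrB -!big_split -!sumrB -big_split /=.
apply: eq_bigr => j _; rewrite /cquad !(mulmxDr, =^~ scalemxAr) !pinner_lin.
by rewrite (cliff_sym j v x) (pinnerC _ v (P j *m x)); ring.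
Qed.

End Clifford.

(** * Traces, ranks and commuting involutions *)

(** In a factorization [E = A *m B] through the rank, [B *m A] is the identity. *)
Lemma mxtrace_idem (K : fieldType) n (E : 'M[K]_n) :
  E *m E = E -> \tr E = (\rank E)%:R.
Proof.
move=> EE; set A := col_base E; set B := row_base E.
have EAB : E = A *m B by rewrite mulmx_base.
have BA : B *m A = 1%:M.
  apply: (row_free_inj (row_base_free E)); apply: (row_full_inj (col_base_full E)).
  by rewrite -/A -/B mul1mx (mulmxA A) (mulmxA A) -EAB -(mulmxA E) -EAB EE.
by rewrite {1}EAB mxtrace_mulC BA mxtrace1.
Qed.

(** Each pair of anticommuting matrices contributes, over a field containing a
    square root of -1, an involution; these involutions commute with each
    other and each of them halves the rank of the product of spectral
    projections. *)
Lemma anticommuting_dvdn (K : numFieldType) (ii : K) n m (Q : 'I_m -> 'M[K]_n)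
    (e : 'I_m -> K) :
  ii * ii = -1 -> (forall k, Q k *m Q k = (e k)%:M) ->
  (forall k, e k = 1 \/ e k = -1) ->
  (forall j k, j != k -> Q j *m Q k = - (Q k *m Q j)) ->
  (2 ^ m./2 %| n)%N.
Proof.
move=> ii2 Qsq e1 Qanti.
suff H k : (k.*2 <= m)%N -> exists E : 'M[K]_n,
    [/\ E *m E = E, forall j : 'I_m, (k.*2 <= j)%N -> E *m Q j = Q j *m E
      & n = (2 ^ k * \rank E)%N].
  have [|E [_ _ ->]] := H m./2; last exact: dvdn_mulr.
  by rewrite -[leqRHS]odd_double_half leq_addl.
elim: k => [|k IH] km.
  exists 1%:M; split; rewrite ?mulmx1 ?mxrank1 ?mul1n // => j _.
  by rewrite mul1mx mulmx1.
have {IH}[|E [EE EQ nE]] := IH; first by lia.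
have ka : (k.*2 < m)%N by lia.
have kb : (k.*2.+1 < m)%N by lia.
(* The next pair; [w] is chosen for [U] to square to 1. *)
pose a := Ordinal ka; pose b := Ordinal kb.
have ab : a != b by rewrite -val_eqE /=; lia.
have [w ww] : exists w : K, w * w * (e a * e b) = -1.
  case: (e1 a) => ->; case: (e1 b) => ->;
    [exists ii | exists 1 | exists 1 | exists ii]; rewrite ?ii2; ring.
pose U := w *: (Q a *m Q b).
have UU : U *m U = 1%:M.
  rewrite /U -scalemxAl -scalemxAr scalerA mulmxA -(mulmxA (Q a)).
  rewrite Qanti 1?eq_sym // mulmxN mulNmx -!mulmxA Qsq mulmxA Qsq.
  by rewrite -scalar_mxM scalerN scale_scalar_mx ww -raddfN /= opprK.
have EU : E *m U = U *m E.
  rewrite /U -scalemxAl -scalemxAr; congr (_ *: _).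
  rewrite (mulmxA E) (EQ a) //= -mulmxA (EQ b) /=; [by rewrite mulmxA | lia].
have UQ (j : 'I_m) : (k.+1.*2 <= j)%N -> U *m Q j = Q j *m U.
  move=> kj; have aj : a != j by rewrite -val_eqE /=; lia.
  have bj : b != j by rewrite -val_eqE /=; lia.
  rewrite /U -scalemxAl -scalemxAr; congr (_ *: _).
  by rewrite -mulmxA (Qanti b j) // mulmxN mulmxA (Qanti a j) // mulNmx opprK mulmxA.
have trEU : \tr (E *m U) = 0.
  have h : \tr (E *m Q a *m Q b) = - \tr (E *m Q a *m Q b).
    rewrite {1}mxtrace_mulC (mulmxA (Q b)) -(EQ b) /=; last by lia.
    by rewrite -mulmxA (Qanti b a) 1?eq_sym // mulmxN raddfN /= mulmxA.
  have h2 : \tr (E *m Q a *m Q b) *+ 2 = 0 by rewrite mulr2n {1}h addNr.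
  rewrite /U -scalemxAr mxtraceZ mulmxA.
  by move/eqP: h2; rewrite mulrn_eq0 /= => /eqP ->; rewrite mulr0.
pose E' := 2^-1 *: (E *m (1%:M + U)).
have half2 : 2^-1 * 2 = 1 :> K by rewrite mulVf ?pnatr_eq0.
have E'E' : E' *m E' = E'.
  rewrite /E' -scalemxAl -scalemxAr; congr (_ *: _).
  have -> : E *m (1%:M + U) *m (E *m (1%:M + U)) = 2 *: (E *m (1%:M + U)).
    have c : (1%:M + U) *m E = E *m (1%:M + U).
      by rewrite mulmxDl mulmxDr mul1mx mulmx1 EU.
    have c2 : (1%:M + U) *m (1%:M + U) = 2 *: (1%:M + U).
      by rewrite mulmxDl mul1mx mulmxDr mulmx1 UU [U + _]addrC -mulr2n -scaler_nat.
    by rewrite mulmxA -(mulmxA E) c mulmxA EE -mulmxA c2 -scalemxAr.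
  by rewrite scalerA half2 scale1r.
exists E'; split=> //.
  move=> j kj; rewrite /E' -scalemxAl -scalemxAr; congr (_ *: _).
  rewrite -mulmxA mulmxDl mul1mx UQ // -{1}[Q j]mulmx1 -mulmxDr mulmxA EQ //.
    by rewrite mulmxA.
  by lia.
have trE' : 2^-1 * (\rank E)%:R = (\rank E')%:R :> K.
  rewrite -(mxtrace_idem E'E') /E' mxtraceZ mulmxDr mulmx1 raddfD /= trEU addr0.
  by rewrite (mxtrace_idem EE).
apply: (etrans nE); rewrite expnSr -mulnA; congr (_ * _)%N.
apply/eqP; rewrite -(eqr_nat K) natrM -trE' mulrA.
by rewrite divff ?pnatr_eq0 // mul1r.
Qed.

(** A sum of operators [1 - S i], the [S i] being commuting involutions, has no
    negative eigenvalue, and its kernel is the common fixed space: on the image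
    of one [1 - S i] the sum of the others has an eigenvalue lowered by 2. *)
Lemma involutions_fixed (K : realFieldType) (V : lmodType K) (I : eqType)
    (S : I -> {linear V -> V}) (t : seq I) (d : K) (W : V) :
  (forall i x, S i (S i x) = x) -> (forall i j x, S i (S j x) = S j (S i x)) ->
  0 <= d -> \sum_(i <- t) (W - S i W) = - (d *: W) ->
  forall i, i \in t -> S i W = W.
Proof.
move=> Sinv Scom; elim: t d W => [//|j t IH] d W d0; rewrite big_cons => hW.
pose W1 := W - S j W.
have SW1 : S j W1 = - W1 by rewrite /W1 raddfB /= Sinv opprB.
have tW1 : \sum_(i <- t) (W1 - S i W1) = - ((d + 2) *: W1).
  have -> : \sum_(i <- t) (W1 - S i W1)
      = \sum_(i <- t) (W - S i W) - S j (\sum_(i <- t) (W - S i W)).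
    rewrite raddf_sum -sumrB; apply: eq_bigr => i _.
    by rewrite /W1 !raddfB /= Scom addrACA.
  have -> : \sum_(i <- t) (W - S i W) = - (d *: W) - W1.
    by rewrite -hW /W1 addrC addKr.
  have SW : S j W = W - W1 by rewrite /W1 opprB addrC subrK.
  have -> : S j (- (d *: W) - W1) = - (d *: (W - W1)) + W1.
    by rewrite linearB /= SW1 opprK linearN /= linearZ /= SW.
  move: {hW SW1 SW} W1 => W1.
  rewrite scalerBr opprD opprK addrACA addKr.
  by rewrite scalerDl scaler_nat mulr2n !opprD.
have W10 : W1 = 0.
  have fx := IH _ _ (addr_ge0 d0 (ler0n _ 2)) tW1.
  move: tW1; rewrite big_seq big1 => [/eqP|i it]; last by rewrite fx // subrr.
  rewrite eq_sym oppr_eq0 scaler_eq0 => /orP[/eqP h|/eqP //].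
  by have : 0 < d + 2 by [apply: ltr_wpDl]; rewrite h ltxx.
move=> i; rewrite inE => /orP[/eqP ->|]; first by apply/esym/eqP; rewrite -subr_eq0; apply/eqP.
by apply: (IH d) => //; rewrite -hW -/W1 W10 add0r.
Qed.

(** * The pseudoscalar of a Clifford system *)

Section Pseudoscalar.
Variables (R : realType) (n s m r : nat) (P : 'I_m -> 'M[R]_n).
Hypothesis hP : clifford_system s r P.
Implicit Types (Q X Y : 'M[R]_n) (j k : 'I_m) (t : seq 'I_m).
Local Notation eta := (csign R r).

Definition cword t : 'M[R]_n := foldr (fun j X => P j *m X) 1%:M t.

Definition pscalar : 'M[R]_n := cword (enum 'I_m).

Lemma cword_comm_notin j t : j \notin t ->
  P j *m cword t = (-1) ^+ size t *: (cword t *m P j).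
Proof.
elim: t => [|i t IH] /=; first by rewrite mulmx1 mul1mx scale1r.
rewrite inE negb_or => /andP[ji jt].
rewrite mulmxA (cliff_anti hP ji) mulNmx -(mulmxA (P i) (P j)) IH // -scalemxAr -scaleNr mulmxA.
by rewrite exprS mulN1r.
Qed.

Lemma cword_comm_in j t : uniq t -> j \in t ->
  P j *m cword t = (-1) ^+ (size t).-1 *: (cword t *m P j).
Proof.
elim: t => [//|i t IH] /= /andP[it ut]; rewrite inE; case: eqVneq => [->|ji] /= jt.
  by rewrite -(mulmxA (P i) (cword t)) scalemxAr -cword_comm_notin.
have t0 : (0 < size t)%N by case: (t) jt.
rewrite mulmxA (cliff_anti hP ji) mulNmx -(mulmxA (P i) (P j)) IH // -scalemxAr -scaleNr mulmxA.
by rewrite -[in RHS](prednK t0) exprS mulN1r.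
Qed.

Lemma cword_padj t : uniq t -> padj s (cword t) = (-1) ^+ 'C(size t, 2) *: cword t.
Proof.
elim: t => [|i t IH] /=; first by rewrite padj1 scale1r.
move=> /andP[it ut]; rewrite padjM IH // (cliff_padj hP) cword_comm_notin // -scalemxAl.
by rewrite scalerA binS bin1 exprD -mulrA -expr2 sqrr_sign mulr1.
Qed.

Lemma cword_mul_padj t : cword t *m padj s (cword t) = (\prod_(j <- t) eta j)%:M.
Proof.
elim: t => [|i t IH] /=; first by rewrite big_nil padj1 mulmx1.
rewrite padjM (cliff_padj hP) mulmxA -(mulmxA (P i) (cword t)) IH mul_mx_scalar -scalemxAl.
by rewrite (cliff_sqr hP) scale_scalar_mx big_cons mulrC.
Qed.

Hypothesis m4 : (4 %| m)%N.
Hypothesis m0 : (0 < m)%N.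

Lemma pscalar_anti j : P j *m pscalar = - (pscalar *m P j).
Proof.
rewrite cword_comm_in ?enum_uniq ?mem_enum // size_enum_ord -signr_odd.
have -> : odd m.-1 by clear -m4 m0; lia.
by rewrite expr1 scaleN1r.
Qed.

Lemma pscalar_padj : padj s pscalar = pscalar.
Proof.
rewrite cword_padj ?enum_uniq // size_enum_ord -signr_odd.
have -> : odd 'C(m, 2) = false; last by rewrite scale1r.
case/dvdnP: m4 => q ->; rewrite bin2 -[RHS](odd_double (q * (q * 4).-1)).
by congr odd; rewrite -muln2; clear; lia.
Qed.

Lemma pscalar_sym : pseudo_sym s pscalar.
Proof. exact/pseudo_symP/pscalar_padj. Qed.

Hypothesis r2 : ~~ odd r.
Hypothesis rm : (r <= m)%N.

Lemma pscalar_sqr : pscalar *m pscalar = 1%:M.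
Proof.
rewrite -{2}pscalar_padj cword_mul_padj big_enum /=; congr (_%:M).
have -> : \prod_(j < m) eta j = \prod_(j < m) (if (j < r)%N then -1 else 1 : R).
  by apply: eq_bigr => j _; rewrite /csign /Jmx !mxE eqxx mulr1n.
rewrite -big_mkcond /= -(big_ord_widen m (fun _ => -1) rm) prodr_const card_ord.
by rewrite -signr_odd (negbTE r2).
Qed.

Lemma comm_cword Q t : (forall j, P j *m Q = Q *m P j) ->
  cword t *m Q = Q *m cword t.
Proof.
move=> h; elim: t => [|i t IH] /=; first by rewrite mulmx1 mul1mx.
by rewrite -mulmxA IH !mulmxA h.
Qed.

(** The algebra generated by the [P j], [j] in [t]: each generator, once put in
    front, enters at most linearly. *)
Fixpoint calg t Q : Prop :=
  match t with
  | [::] => exists a : R, Q = a%:M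
  | j :: t' => exists X Y, [/\ calg t' X, calg t' Y & Q = X + P j *m Y]
  end.

Lemma calg_scalar t a : calg t a%:M.
Proof.
elim: t a => [|j t IH] a /=; first by exists a.
exists a%:M, 0; split=> //; last by rewrite mulmx0 addr0.
by rewrite -(raddf0 (@scalar_mx _ n)); apply: IH.
Qed.

Lemma calg_lin t a X Y : calg t X -> calg t Y -> calg t (a *: X + Y).
Proof.
elim: t X Y => [|j t IH] X Y /=.
  by case=> b -> [c ->]; exists (a * b + c); rewrite scale_scalar_mx -raddfD.
case=> X1 [X2 [h1 h2 ->]] [Y1 [Y2 [h3 h4 ->]]].
exists (a *: X1 + Y1), (a *: X2 + Y2); split; [exact: IH | exact: IH |].
by rewrite scalerDr mulmxDr -scalemxAr addrACA.
Qed.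

Lemma calg0 t : calg t 0.
Proof. by rewrite -(raddf0 (@scalar_mx _ n)); apply: calg_scalar. Qed.

Lemma calgZ t a X : calg t X -> calg t (a *: X).
Proof. by move=> h; rewrite -[_ *: _]addr0; apply: calg_lin => //; apply: calg0. Qed.

Lemma calg_mul j t Q : j \in t -> calg t Q -> calg t (P j *m Q).
Proof.
elim: t Q => [//|i t IH] Q; rewrite inE => jt /= [X [Y [hX hY ->]]].
case: (eqVneq j i) jt => [-> _ | ji /= jt].
  exists (eta i *: Y), X; split=> //; first exact: calgZ.
  by rewrite mulmxDr mulmxA (cliff_sqr hP) mul_scalar_mx addrC.
exists (P j *m X), (-1 *: (P j *m Y)); split; [exact: IH | exact/calgZ/IH |].
by rewrite mulmxDr mulmxA (cliff_anti hP ji) mulNmx -mulmxA scaleN1r mulmxN.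
Qed.

(** Conjugation by the pseudoscalar is the parity automorphism of the Clifford
    algebra, and parity is what a further generator detects. *)
Lemma calg_parity j t X : j \notin t -> calg t X ->
  P j *m X = pscalar *m X *m pscalar *m P j.
Proof.
elim: t X => [|i t IH] X /=.
  move=> _ [a ->]; rewrite !mul_mx_scalar -scalemxAl pscalar_sqr.
  by rewrite scalemx1 mul_scalar_mx.
rewrite inE negb_or => /andP[ji jt] [X1 [X2 [h1 h2 ->]]].
rewrite !mulmxDr !mulmxDl IH //; congr (_ + _).
rewrite mulmxA (cliff_anti hP ji) mulNmx -(mulmxA (P i) (P j)) IH // !mulmxA.
by rewrite (pscalar_anti i) !mulNmx opprK.
Qed.

(** For the leading generator [P j] write [Q = X + P j *m Y], and let [al] be
    the parity. Invariance under parity gives [Q = al X - P j *m al Y], and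
    commutation with [P j] gives [Q = al X + P j *m al Y]. Hence [Q = al X],
    so that [P j] does not occur in [Q]. *)
Lemma calg_center t Q : uniq t -> calg t Q ->
  (forall j, P j *m Q = Q *m P j) -> exists a : R, Q = a%:M.
Proof.
elim: t Q => [//|j t IH] Q /= /andP[jt ut] [X [Y [hX hY QE]]] cQ.
apply: IH => //; suff -> : Q = X by [].
pose al Z := pscalar *m Z *m pscalar.
have alQ : al Q = Q by rewrite /al (comm_cword _ cQ) -mulmxA pscalar_sqr mulmx1.
have Pinv Z : eta j *: (Z *m P j *m P j) = Z.
  by rewrite -mulmxA (cliff_sqr hP) mul_mx_scalar scalerA csign_sqr scale1r.
have Qm : Q = al X - P j *m al Y.
  rewrite -[LHS]alQ QE /al mulmxDr mulmxDl; congr (_ + _).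
  by rewrite !mulmxA pscalar_anti !mulNmx opprK.
have Qp : Q = al X + P j *m al Y.
  rewrite -[LHS]Pinv -cQ QE mulmxDr (calg_parity jt hX) (calg_parity jt hY).
  by rewrite -!/(al _) mulmxA -mulmxDl Pinv.
have QalX : Q = al X.
  have two : 2%:R != 0 :> R by rewrite pnatr_eq0.
  apply: (scalerI two); rewrite !scaler_nat !mulr2n {1}Qm {1}Qp.
  by rewrite addrACA addNr addr0.
rewrite -{1}alQ {1}QalX /al !mulmxA pscalar_sqr mul1mx -mulmxA pscalar_sqr.
by rewrite mulmx1.
Qed.

End Pseudoscalar.

Definition in_span (R : realType) n m (P : 'I_m -> 'M[R]_n) (Q : 'M[R]_n) :=
  exists a : 'I_m -> R, Q = \sum_j a j *: P j.

(** The product of the two pseudoscalars lies in the Clifford algebra and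
    commutes with its generators; since an even number of generators leaves
    no centre but the scalars, it is a scalar of square 1. *)
Lemma pscalar_unique (R : realType) n s m r (P P' : 'I_m -> 'M[R]_n) :
  clifford_system s r P -> clifford_system s r P' ->
  (4 %| m)%N -> ~~ odd r -> (r <= m)%N -> (0 < m)%N ->
  (forall k, in_span P (P' k)) -> (forall k, in_span P' (P k)) ->
  pscalar P' = pscalar P \/ pscalar P' = - pscalar P.
Proof.
move=> hP hP' m4 r2 rm m0 sP' sP.
pose W := pscalar P *m pscalar P'.
have antiP' j : P j *m pscalar P' = - (pscalar P' *m P j).
  have [a ->] := sP j; rewrite mulmx_suml mulmx_sumr -sumrN.
  apply: eq_bigr => k _; rewrite -scalemxAl -scalemxAr (pscalar_anti hP' m4 m0).
  by rewrite scalerN.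
have cW j : P j *m W = W *m P j.
  rewrite /W mulmxA (pscalar_anti hP m4 m0) mulNmx -(mulmxA _ (P j)) antiP' mulmxN opprK.
  by rewrite mulmxA.
have aW : calg P (enum 'I_m) W.
  have step t X : calg P (enum 'I_m) X -> calg P (enum 'I_m) (cword P t *m X).
    move=> hX; elim: t => [|i t IH] /=; first by rewrite mul1mx.
    by rewrite -mulmxA; apply: (calg_mul hP) => //; rewrite mem_enum.
  apply: step; rewrite /(pscalar P'); elim: (X in cword P' X) => [|k t IH] /=.
    exact: calg_scalar.
  have [a ->] := sP' k; rewrite mulmx_suml; elim/big_ind: _ => [|X Y hX hY|j _].
  - exact: calg0.
  - by rewrite -[X]scale1r; apply: calg_lin.
  - by rewrite -scalemxAl; apply: calgZ; apply: (calg_mul hP) => //; rewrite mem_enum.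
have [w wE] := calg_center hP m4 m0 r2 rm (enum_uniq _) aW cW.
have PwP : pscalar P' = w *: pscalar P.
  by rewrite -[LHS]mul1mx -(pscalar_sqr hP m4 r2 rm) -mulmxA -/W wE mul_mx_scalar.
have [n0|n0] := posnP n.
  by left; apply/matrixP=> i; have := ltn_ord i; rewrite {2}n0.
have : w * w = 1.
  have := pscalar_sqr hP' m4 r2 rm; rewrite PwP -scalemxAl -scalemxAr scalerA.
  rewrite (pscalar_sqr hP m4 r2 rm) => /matrixP /(_ (Ordinal n0) (Ordinal n0)).
  by rewrite !mxE eqxx mulr1.
move/eqP; rewrite -expr2 sqrf_eq1 PwP => /orP[] /eqP ->; [left|right].
  by rewrite scale1r.
by rewrite scaleN1r.
Qed.

(** * The quartic form determines the span of the Clifford system *)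

Section Quartic.
Variables (R : realType) (n s m r : nat) (P : 'I_m -> 'M[R]_n).
Implicit Types (u v w x y z : 'cV[R]_n) (Q V : 'M[R]_n) (j k : 'I_m).
Local Notation eta := (csign R r).
Local Notation ip := (pinner s).
Local Notation J := (Jmx R s n).

(** Three times the full polarization of [csum]. *)
Definition cform x z y w : R := \sum_j eta j *
  (ip (P j *m x) z * ip (P j *m y) w + ip (P j *m x) y * ip (P j *m z) w
   + ip (P j *m x) w * ip (P j *m z) y).

(** The contraction of [cform] with [Q] in two of its arguments, as
    [cliff_contractE] shows for symmetric [Q]. *)
Definition cliff_contract Q : 'M[R]_n :=
  \sum_j (eta j * \tr (P j *m Q)) *: P j
  + 2 *: \sum_j eta j *: (P j *m Q *m P j).

Hypothesis hP : clifford_system s r P.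

Lemma cform_polar x z y w :
  16 * cform x z y w =
    (cform (x + z) (x + z) (y + w) (y + w) - cform (x - z) (x - z) (y + w) (y + w))
    - (cform (x + z) (x + z) (y - w) (y - w) - cform (x - z) (x - z) (y - w) (y - w)).
Proof.
rewrite /cform mulr_sumr -!sumrB; apply: eq_bigr => j _.
rewrite !(mulmxDr, mulmxN) !pinner_lin.
rewrite !(cliff_sym hP j z) !(pinnerC _ z (P j *m _)).
rewrite !(cliff_sym hP j w) !(pinnerC _ w (P j *m _)).
ring.
Qed.

Lemma cform_csum x y :
  4 * cform x x y y = csum s r P (x + y) + csum s r P (x - y)
    - 2 * csum s r P x - 2 * csum s r P y.
Proof.
rewrite /cform /csum !mulr_sumr -big_split -!sumrB /=; apply: eq_bigr => j _.
rewrite /cquad !(mulmxDr, mulmxN) !pinner_lin.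
rewrite (cliff_sym hP j y x) (pinnerC _ y (P j *m _)).
ring.
Qed.

Lemma pinner_delta (a : 'I_n) u : ip (delta_mx a 0) u = (J *m u) a 0.
Proof.
by rewrite /pinner trmx_delta -mulmxA -rowE mxE.
Qed.

Lemma cliff_contractE Q y w : pseudo_sym s Q ->
  ip (cliff_contract Q *m y) w =
  \sum_a \sum_b (Q *m J) a b * cform (delta_mx a 0) (delta_mx b 0) y w.
Proof.
move=> hQ.
have bil u v : \sum_a \sum_b (Q *m J) a b * (ip (delta_mx a 0) u * ip (delta_mx b 0) v)
    = ip u (Q *m v).
  rewrite exchange_big /=.
  have -> : ip u (Q *m v) = ((J *m u)^T *m (Q *m J) *m (J *m v)) 0 0.
    rewrite /pinner trmx_mul trJ !mulmxA -(mulmxA (u^T *m J *m Q)) mulJJ.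
    by rewrite mulmx1.
  rewrite mxE; apply: eq_bigr => b _; rewrite [X in _ = X * _]mxE mulr_suml.
  by apply: eq_bigr => a _; rewrite !pinner_delta [in RHS]mxE; ring.
have trc j : \sum_a \sum_b (Q *m J) a b * ip (P j *m delta_mx a 0) (delta_mx b 0)
    = \tr (P j *m Q).
  have -> : \tr (P j *m Q) = \tr (Q *m J *m (J *m P j)).
    by rewrite mulmxA -(mulmxA Q) mulJJ mulmx1 mxtrace_mulC.
  rewrite /mxtrace; apply: eq_bigr => a _; rewrite [RHS]mxE; apply: eq_bigr => b _.
  by rewrite pinnerC pinner_delta mulmxA -colE; congr (_ * _); rewrite mxE.
rewrite /cliff_contract mulmxDl -scalemxAl !mulmx_suml pinnerDl pinnerZl !pinner_suml.
rewrite mulr_sumr -big_split /=.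
transitivity (\sum_j \sum_a \sum_b (Q *m J) a b * (eta j *
  (ip (P j *m delta_mx a 0) (delta_mx b 0) * ip (P j *m y) w
   + ip (delta_mx a 0) (P j *m y) * ip (delta_mx b 0) (P j *m w)
   + ip (delta_mx a 0) (P j *m w) * ip (delta_mx b 0) (P j *m y)))); last first.
  rewrite exchange_big; apply: eq_bigr => a _; rewrite exchange_big.
  apply: eq_bigr => b _; rewrite /cform mulr_sumr; apply: eq_bigr => j _.
  by rewrite !(cliff_sym hP j (delta_mx _ _)).
apply: eq_bigr => j _.
have -> : ip (eta j *: (P j *m Q *m P j) *m y) w
    = eta j * ip (P j *m y) (Q *m (P j *m w)).
  by rewrite -scalemxAl pinnerZl -!mulmxA (cliff_sym hP) hQ.
transitivity (eta j * (\tr (P j *m Q) * ip (P j *m y) w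
   + ip (P j *m y) (Q *m (P j *m w)) + ip (P j *m w) (Q *m (P j *m y)))).
  rewrite -scalemxAl pinnerZl [ip (P j *m w) _]pinnerC hQ; ring.
rewrite -trc -!bil mulr_suml -!big_split mulr_sumr; apply: eq_bigr => a _ /=.
rewrite mulr_suml -!big_split mulr_sumr; apply: eq_bigr => b _ /=; ring.
Qed.

Lemma mxtrace_cliff j k : \tr (P j *m P k) = n%:R * eta j *+ (j == k).
Proof.
case: (eqVneq j k) => [<-|jk].
  by rewrite (cliff_sqr hP) mxtrace_scalar mulr1n mulr_natl.
have h : \tr (P j *m P k) = - \tr (P j *m P k).
  by rewrite {1}mxtrace_mulC (cliff_anti hP jk) raddfN opprK.
by rewrite mulr0n; lra.
Qed.

Lemma conj_sum_cliff k : \sum_j eta j *: (P j *m P k *m P j) = (2 - m%:R) *: P k.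
Proof.
rewrite (bigD1 k) //= (cliff_sqr hP) mul_scalar_mx scalerA csign_sqr scale1r.
under eq_bigr => j jk.
  rewrite (cliff_anti hP jk) mulNmx -mulmxA (cliff_sqr hP) mul_mx_scalar.
  rewrite scalerN scalerA csign_sqr scale1r; over.
rewrite sumr_const cardC1 card_ord.
rewrite -[X in X + _]scale1r -scaler_nat scalerN -scaleNr -scalerDl; congr (_ *: _).
have m0 : (0 < m)%N by apply: leq_ltn_trans (ltn_ord k).
by rewrite -subn1 natrB //; ring.
Qed.

Lemma cliff_contract_gen k : cliff_contract (P k) = (n%:R + 4 - 2 * m%:R) *: P k.
Proof.
rewrite /cliff_contract conj_sum_cliff (bigD1 k) //= big1 ?addr0 => [|j jk].
  rewrite mxtrace_cliff eqxx mulr1n mulrCA csign_sqr mulr1 scalerA -scalerDl.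
  by congr (_ *: _); ring.
by rewrite mxtrace_cliff (negbTE jk) mulr0n mulr0 scale0r.
Qed.

Lemma cliff_contract_lin a Q V : cliff_contract (a *: Q + V) = a *: cliff_contract Q + cliff_contract V.
Proof.
rewrite /cliff_contract scalerDr addrACA; congr (_ + _).
  rewrite scaler_sumr -big_split; apply: eq_bigr => j _ /=.
  rewrite mulmxDr -scalemxAr mxtraceD mxtraceZ mulrDr scalerDl scalerA.
  by rewrite mulrCA.
rewrite (scalerA a) [a * 2]mulrC -scalerA -scalerDr; congr (_ *: _).
rewrite scaler_sumr -big_split; apply: eq_bigr => j _ /=.
by rewrite mulmxDr mulmxDl scalerDr -scalemxAr -scalemxAl !scalerA mulrC.
Qed.

End Quartic.

(** For [a = eta k] and [A = P k] this is conjugation by [P k], as a linear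
    operator. *)
Definition conjop (R : comPzRingType) n (a : R) (A Q : 'M[R]_n) := a *: (A *m Q *m A).

Fact conjop_linear (R : comPzRingType) n a A : linear (@conjop R n a A).
Proof.
move=> b X Y; rewrite /conjop mulmxDr mulmxDl scalerDr -scalemxAr -scalemxAl.
by rewrite !scalerA mulrC.
Qed.

HB.instance Definition _ (R : comPzRingType) n a A :=
  GRing.isLinear.Build R 'M[R]_n 'M[R]_n _ (@conjop R n a A) (@conjop_linear R n a A).

Section ConjClifford.
Variables (R : realType) (n s m r : nat) (P : 'I_m -> 'M[R]_n).
Hypothesis hP : clifford_system s r P.
Local Notation eta := (csign R r).
Variable e : R.
Hypothesis e1 : e * e = 1.

Lemma conjop_inv k Q : conjop (e * eta k) (P k) (conjop (e * eta k) (P k) Q) = Q.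
Proof.
rewrite /conjop -scalemxAr -scalemxAl scalerA !mulmxA (cliff_sqr hP) mul_scalar_mx.
rewrite -!scalemxAl -mulmxA (cliff_sqr hP) mul_mx_scalar !scalerA.
rewrite -[RHS]scale1r; congr (_ *: _).
transitivity ((e * e) * ((eta k * eta k) * (eta k * eta k))); first by ring.
by rewrite e1 !csign_sqr !mulr1.
Qed.

Lemma conjop_comm j k Q : conjop (e * eta j) (P j) (conjop (e * eta k) (P k) Q)
  = conjop (e * eta k) (P k) (conjop (e * eta j) (P j) Q).
Proof.
have [->//|jk] := eqVneq j k.
rewrite /conjop -!scalemxAr -!scalemxAl !scalerA mulrC; congr (_ *: _).
transitivity ((P j *m P k) *m Q *m (P k *m P j)); first by rewrite !mulmxA.
transitivity ((P k *m P j) *m Q *m (P j *m P k)); last by rewrite !mulmxA.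
by rewrite (cliff_anti hP jk) mulmxN !mulNmx.
Qed.

(** When the sum of the [m] conjugations takes on [V] a value of modulus at
    least [m], none of them has a choice. *)
Lemma conj_extreme d V : 0 <= d ->
  \sum_j eta j *: (P j *m V *m P j) = (e * (m%:R + d)) *: V ->
  forall k, P k *m V = e *: (V *m P k).
Proof.
move=> d0 hV k.
have := @involutions_fixed R _ _ (fun k => conjop (e * eta k) (P k)) (enum 'I_m) d V
  conjop_inv conjop_comm d0.
rewrite big_enum /= sumrB sumr_const card_ord.
have -> : \sum_(i < m) conjop (e * eta i) (P i) V = (m%:R + d) *: V.
  rewrite /conjop; under eq_bigr do rewrite -scalerA.
  by rewrite -scaler_sumr hV scalerA mulrA e1 mul1r.
rewrite -scaler_nat -scalerBl opprD addrA subrr add0r scaleNr => /(_ erefl k).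
rewrite mem_enum => /(_ isT); rewrite /conjop => h.
rewrite -[in RHS]h -!scalemxAl -(mulmxA (P k *m V)) (cliff_sqr hP) mul_mx_scalar !scalerA.
rewrite -[LHS]scale1r; congr (_ *: _).
transitivity ((e * e) * (eta k * eta k)); last by ring.
by rewrite e1 csign_sqr mulr1.
Qed.

End ConjClifford.

Section Determined.
Variables (R : realType) (n s m r : nat).
Hypotheses (m4 : (4 %| m)%N) (r2 : ~~ odd r) (rm : (r <= m)%N) (m0 : (0 < m)%N).
Hypothesis nm : (4 * m <= n + 4)%N.
Variables (P P' : 'I_m -> 'M[R]_n).
Hypotheses (hP : clifford_system s r P) (hP' : clifford_system s r P').
Hypothesis csumE : forall x, csum s r P x = csum s r P' x.
Local Notation eta := (csign R r).

Lemma cliff_contract_eq Q : pseudo_sym s Q -> cliff_contract r P Q = cliff_contract r P' Q.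
Proof.
move=> hQ; apply/eqP; rewrite -subr_eq0; apply/eqP/matrixP=> i j.
suff h y : (cliff_contract r P Q - cliff_contract r P' Q) *m y = 0 :> 'cV_n.
  by have := h (delta_mx j 0); rewrite -colE => /colP /(_ i); rewrite !mxE.
apply: (@pinner_nondeg _ _ s) => w; rewrite mulmxBl pinnerDl pinnerNl.
apply/eqP; rewrite subr_eq0 (cliff_contractE hP) // (cliff_contractE hP') //; apply/eqP.
have fE x z : cform s r P x x z z = cform s r P' x x z z.
  have f4 : 4%:R != 0 :> R by rewrite pnatr_eq0.
  by apply: (mulfI f4); rewrite (cform_csum hP) (cform_csum hP') !csumE.
apply: eq_bigr => a _; apply: eq_bigr => b _; congr (_ * _).
have f16 : 16%:R != 0 :> R by rewrite pnatr_eq0.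
by apply: (mulfI f16); rewrite (cform_polar hP) (cform_polar hP') !fE.
Qed.

(** The pseudoscalar of [P] is an eigenvector of the contraction operator for
    the eigenvalue [- 2 m]. For the operator as built from [P'], this is the
    smallest eigenvalue, attained only by what anticommutes with all [P' k]. *)
Lemma pscalar_anti_other k : P' k *m pscalar P = - (pscalar P *m P' k).
Proof.
set S := pscalar P.
have trS j : \tr (P j *m S) = 0.
  have h : \tr (P j *m S) = - \tr (P j *m S).
    by rewrite {1}(pscalar_anti hP m4 m0) raddfN /= mxtrace_mulC.
  by lra.
have cS : cliff_contract r P S = (- (2 * m%:R)) *: S.
  rewrite /cliff_contract big1 ?add0r => [|j _]; last by rewrite trS mulr0 scale0r.
  under eq_bigr => j _.
    rewrite (pscalar_anti hP m4 m0) mulNmx -mulmxA (cliff_sqr hP) mul_mx_scalar.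
    rewrite scalerN scalerA csign_sqr scale1r; over.
  by rewrite sumr_const card_ord -[_ *+ m]scaler_nat !scalerN scalerA scaleNr.
have cS' : cliff_contract r P' S = (- (2 * m%:R)) *: S.
  by rewrite -cS cliff_contract_eq //; exact: (pscalar_sym hP m4).
have trS' j : \tr (P' j *m S) = 0.
  have := congr1 (fun Q => \tr (P' j *m Q)) cS'.
  rewrite /cliff_contract mulmxDr raddfD /= -!scalemxAr !mxtraceZ !mulmx_sumr !raddf_sum /=.
  rewrite (bigD1 j) //= big1 ?addr0 => [|i ij]; last first.
    by rewrite -scalemxAr mxtraceZ (mxtrace_cliff hP') eq_sym (negbTE ij) mulr0.
  have -> : \sum_i \tr (P' j *m (eta i *: (P' i *m S *m P' i)))
      = \tr ((\sum_i eta i *: (P' i *m P' j *m P' i)) *m S).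
    rewrite mulmx_suml raddf_sum; apply: eq_bigr => i _ /=.
    rewrite -scalemxAr -scalemxAl !mxtraceZ; congr (_ * _).
    by rewrite mulmxA mxtrace_mulC !mulmxA.
  rewrite (conj_sum_cliff hP') -!scalemxAl -scalemxAr !mxtraceZ (mxtrace_cliff hP').
  rewrite eqxx mulr1n => h.
  have e1 : eta j * \tr (P' j *m S) * (n%:R * eta j) = n%:R * \tr (P' j *m S).
    by rewrite -[RHS]mul1r -(csign_sqr R r j); ring.
  rewrite e1 in h.
  have : (n%:R + 4) * \tr (P' j *m S) = 0 by lra.
  move/eqP; rewrite mulf_eq0 => /orP[/eqP h4|/eqP //].
  by have : 0 < n%:R + 4 :> R; [apply: ltr_wpDl | rewrite h4 ltxx].
have := @conj_extreme R n s m r P' hP' (-1) _ 0 S (lexx 0).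
rewrite mulrNN mulr1 addr0 => /(_ erefl) h; rewrite h ?scaleN1r //.
move: cS'; rewrite /cliff_contract big1 ?add0r => [|j _]; last by rewrite trS' mulr0 scale0r.
have two : 2%:R != 0 :> R by rewrite pnatr_eq0.
move=> h2; apply: (scalerI two); rewrite h2 scalerA; congr (_ *: _); ring.
Qed.

(** Projecting [P' k] onto the span of [P] leaves a remainder [V] that is an
    eigenvector of the sum of the conjugations by the [P j] for the eigenvalue
    [n/2 + 2 - m], which is at least [m]. Hence [V] commutes with all [P j],
    so with their product; but like [P' k] it anticommutes with it. *)
Lemma in_span_other k : in_span P (P' k).
Proof.
pose a j := eta j * \tr (P j *m P' k) / n%:R.
pose U := \sum_j a j *: P j; pose V := P' k - U.
have [n0|n0] := posnP n.
  by exists (fun=> 0); apply/matrixP=> i; have := ltn_ord i; rewrite {2}n0.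
have nR : n%:R != 0 :> R by rewrite pnatr_eq0 -lt0n.
suff V0 : V = 0 by exists a; apply/eqP; rewrite -subr_eq0 -/U -/V V0.
pose mu : R := n%:R + 4 - 2 * m%:R.
have cU : cliff_contract r P U = mu *: U.
  rewrite /U; elim/big_rec: _ => [|j X _ hX].
    by have := cliff_contract_lin r P (-1) 0 0; rewrite !scaler0 scaleN1r addr0 addNr.
  by rewrite cliff_contract_lin (cliff_contract_gen hP) hX scalerDr !scalerA mulrC.
have cV : cliff_contract r P V = mu *: V.
  have := cliff_contract_lin r P (-1) U (P' k); rewrite scaleN1r [- U + _]addrC -/V => ->.
  rewrite cU cliff_contract_eq; last by case: hP'.
  by rewrite (cliff_contract_gen hP') scaleN1r addrC -scalerBr.
have trV j : \tr (P j *m V) = 0.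
  have trU : \tr (P j *m U) = \tr (P j *m P' k).
    rewrite /U mulmx_sumr raddf_sum (bigD1 j) //= big1 ?addr0 => [|i ij]; last first.
      by rewrite -scalemxAr mxtraceZ (mxtrace_cliff hP) eq_sym (negbTE ij) mulr0.
    rewrite -scalemxAr mxtraceZ (mxtrace_cliff hP) eqxx mulr1n /a.
    transitivity ((n%:R / n%:R) * (eta j * eta j) * \tr (P j *m P' k)).
      by ring.
    by rewrite divff // csign_sqr !mul1r.
  by rewrite /V mulmxBr raddfB /= trU subrr.
have cVs j : P j *m V = V *m P j.
  pose d : R := n%:R / 2 + 2 - 2 * m%:R.
  have d0 : 0 <= d.
    have : (4 * m)%:R <= (n + 4)%:R :> R by rewrite ler_nat.
    by rewrite natrM natrD /d => h; lra.
  have := @conj_extreme R n s m r P hP 1 _ d V d0; rewrite !mul1r => /(_ erefl) h.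
  rewrite h ?scale1r //; move: cV.
  rewrite /cliff_contract big1 ?add0r => [|i _]; last by rewrite trV mulr0 scale0r.
  have two : 2%:R != 0 :> R by rewrite pnatr_eq0.
  move=> h2; apply: (scalerI two); rewrite h2 scalerA; congr (_ *: _).
  by rewrite /d /mu; lra.
have cSV : pscalar P *m V = V *m pscalar P by apply: comm_cword.
have aSV : V *m pscalar P = - (pscalar P *m V).
  rewrite /V mulmxBl mulmxBr pscalar_anti_other opprD; congr (_ + _).
  rewrite opprK /U mulmx_suml mulmx_sumr -sumrN; apply: eq_bigr => j _.
  by rewrite -scalemxAl -scalemxAr (pscalar_anti hP m4 m0) scalerN opprK.
have SV0 : pscalar P *m V = 0.
  have two : 2%:R != 0 :> R by rewrite pnatr_eq0.
  by apply: (scalerI two); rewrite scaler0 scaler_nat mulr2n {1}cSV aSV addNr.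
by rewrite -[V]mul1mx -(pscalar_sqr hP m4 r2 rm) -mulmxA SV0 mulmx0.
Qed.

End Determined.

(** * The dimension of a Clifford module *)

Lemma clifford_dvdn (R : realType) n s m r (P : 'I_m -> 'M[R]_n) :
  clifford_system s r P -> (2 ^ m./2 %| n)%N.
Proof.
move=> hP; pose C := R[i]%C; pose f := real_complex R.
apply: (@anticommuting_dvdn C 'i%C n m (fun k => map_mx f (P k)) (fun k => f (csign R r k))).
- by rewrite -expr2 sqr_i.
- by move=> k; rewrite -map_mxM (cliff_sqr hP) map_scalar_mx.
- move=> k; have := csign_sqr R r k; move/eqP; rewrite -expr2 sqrf_eq1.
  by case/orP => /eqP ->; [left | right]; rewrite /f ?rmorphN rmorph1.
- by move=> j k jk; rewrite -!map_mxM (cliff_anti hP jk) map_mxN.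
Qed.

(** For [m = 4] the divisibility makes [l] even, so that [l > 4] becomes
    [l >= 6]; for [m = 8] it turns [l > 8] into [l >= 16]; beyond that the power
    of 2 alone exceeds the bound. *)
Lemma clifford_dim (R : realType) l s m r (P : 'I_m -> 'M[R]_(2 * l)) :
  clifford_system s r P -> (4 %| m)%N -> (m < l)%N -> (4 * m <= 2 * l + 4)%N.
Proof.
move=> hP m4 ml; have /dvdnP[d dE] := clifford_dvdn hP.
have d0 : (0 < d)%N by case: d dE => //; lia.
case/dvdnP: m4 => q qE; move: ml dE; rewrite {P hP}qE => ml.
rewrite (_ : (q * 4)./2 = (2 * q)%N); last by lia.
rewrite expnM -[(2 ^ 2)%N]/4%N.
case: q ml => [|[|[|q]]] ml; first by move=> _.
- by rewrite expn1; lia.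
- by rewrite expnS expn1; clear -ml d0; lia.
have : (16 * q.+3 <= 4 ^ q.+3)%N.
  by elim: q {ml} => [|q IH]; [rewrite !expnS expn0 | rewrite expnS; lia].
by move: (4 ^ q.+3)%N => e he dE; nia.
Qed.

(** * Curves in the level sets *)

Section VectorCurves.
Variables (R : realType) (n s : nat).
Implicit Types (z w : R -> 'cV[R]_n) (v u : 'cV[R]_n) (f h : R -> R).

(** Working entrywise reduces all derivatives to those of real functions. *)
Definition vder z v := forall i, is_derive (0 : R) 1 (fun t => z t i 0) (v i 0).
Definition vcont (T : topologicalType) (z : T -> 'cV[R]_n) t :=
  forall i, {for t, continuous (fun t => z t i 0)}.

Lemma is_derive_bigsum k (F : 'I_k -> R -> R) (d : 'I_k -> R) (a : R) :
  (forall i, is_derive a 1 (F i) (d i)) ->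
  is_derive a 1 (fun t => \sum_i F i t) (\sum_i d i).
Proof.
move=> h; rewrite (_ : (fun t => _) = \sum_i F i); first exact: is_derive_sum.
by apply/funext => t; rewrite fct_sumE.
Qed.

Lemma cont_bigsum (T : topologicalType) k (F : 'I_k -> T -> R) (a : T) :
  (forall i, {for a, continuous (F i)}) ->
  {for a, continuous (fun b => \sum_i F i b)}.
Proof.
move=> h; rewrite (_ : (fun _ => _) = \sum_i F i); last first.
  by apply/funext => b; rewrite fct_sumE.
elim/big_ind: _ => [|f g cf cg|i _]; [exact: cvg_cst | exact: cvgD | exact: h].
Qed.

Lemma is_derive_prod f h a b : is_derive (0 : R) 1 f a -> is_derive (0 : R) 1 h b ->
  is_derive (0 : R) 1 (fun t => f t * h t) (a * h 0 + f 0 * b).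
Proof.
move=> hf hh; have := is_deriveM hf hh => /is_derive_eq; apply.
by rewrite /GRing.scale /= addrC mulrC [f 0 * b]mulrC; ring.
Qed.

Lemma vderM z v (Q : 'M[R]_n) : vder z v -> vder (fun t => Q *m z t) (Q *m v).
Proof.
move=> h i; rewrite (_ : (fun t => _) = (fun t => \sum_j Q i j * z t j 0)); last first.
  by apply/funext => t; rewrite mxE.
rewrite mxE; apply: is_derive_bigsum => j.
apply: is_derive_eq (is_derive_prod (is_derive_cst (Q i j) _ _) (h j)) _.
by rewrite mul0r add0r.
Qed.

Lemma vderZ z v f a : is_derive (0 : R) 1 f a -> vder z v ->
  vder (fun t => f t *: z t) (a *: z 0 + f 0 *: v).
Proof.
move=> hf hz i; rewrite (_ : (fun t => _) = (fun t => f t * z t i 0)); last first.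
  by apply/funext => t; rewrite mxE.
by rewrite !mxE; apply: is_derive_prod.
Qed.

Lemma vderD z w v u : vder z v -> vder w u -> vder (fun t => z t + w t) (v + u).
Proof.
move=> hz hw i; rewrite (_ : (fun t => _) = (fun t => z t i 0) \+ (fun t => w t i 0)).
  by rewrite mxE; apply: is_deriveD.
by apply/funext => t; rewrite mxE.
Qed.

Lemma vder_sum k (F : 'I_k -> R -> 'cV[R]_n) d : (forall j, vder (F j) (d j)) ->
  vder (fun t => \sum_j F j t) (\sum_j d j).
Proof.
move=> h i; rewrite (_ : (fun t => _) = (fun t => \sum_j F j t i 0)); last first.
  by apply/funext => t; rewrite summxE.
by rewrite summxE; apply: is_derive_bigsum => j; apply: h.
Qed.

Lemma is_derive_pinner z w v u : vder z v -> vder w u ->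
  is_derive (0 : R) 1 (fun t => pinner s (z t) (w t))
    (pinner s v (w 0) + pinner s (z 0) u).
Proof.
move=> hz hw.
rewrite (_ : (fun t => _) = (fun t => \sum_i Jmx R s n i i * (z t i 0 * w t i 0))).
  rewrite !pinnerE -big_split; apply: is_derive_bigsum => i /=.
  apply: is_derive_eq (is_derive_prod (is_derive_cst _ _ _) (is_derive_prod (hz i) (hw i))) _.
  by rewrite mul0r add0r mulrDr.
by apply/funext => t; rewrite pinnerE.
Qed.

(** A factor vanishing at 0 makes the continuity of the other one enough. *)
Lemma is_derive_vanish f h a : f 0 = 0 -> is_derive (0 : R) 1 f a ->
  {for 0, continuous h} -> is_derive (0 : R) 1 (fun t => f t * h t) (a * h 0).
Proof.
move=> f0 /is_derive1_caratheodory[g [gE gc ga]] hc; apply/is_derive1_caratheodory.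
exists (fun t => g t * h t); split; last by rewrite ga.
  by move=> t; rewrite f0 mul0r !subr0; have := gE t; rewrite f0 !subr0 => ->; ring.
exact: cvgM.
Qed.

Lemma vcontM (T : topologicalType) (z : T -> 'cV[R]_n) t (Q : 'M[R]_n) : vcont z t -> vcont (fun t => Q *m z t) t.
Proof.
move=> h i; rewrite (_ : (fun t => _) = (fun t => \sum_j Q i j * z t j 0)); last first.
  by apply/funext => u; rewrite mxE.
by apply: cont_bigsum => j; apply: cvgM; [exact: cvg_cst | exact: h].
Qed.

Lemma vcontZ (T : topologicalType) (z : T -> 'cV[R]_n) t (f : T -> R) :
  {for t, continuous f} -> vcont z t -> vcont (fun t => f t *: z t) t.
Proof.
move=> hf hz i; rewrite (_ : (fun t => _) = (fun t => f t * z t i 0)); last first.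
  by apply/funext => u; rewrite mxE.
by apply: cvgM => //; exact: hz.
Qed.

Lemma vcontD (T : topologicalType) (z w : T -> 'cV[R]_n) t :
  vcont z t -> vcont w t -> vcont (fun t => z t + w t) t.
Proof.
move=> hz hw i; rewrite (_ : (fun t => _) = (fun t => z t i 0 + w t i 0)); last first.
  by apply/funext => u; rewrite mxE.
by apply: cvgD; [exact: hz | exact: hw].
Qed.

Lemma vcont_sum (T : topologicalType) k (F : 'I_k -> T -> 'cV[R]_n) t :
  (forall j, vcont (F j) t) ->
  vcont (fun t => \sum_j F j t) t.
Proof.
move=> h i; rewrite (_ : (fun t => _) = (fun t => \sum_j F j t i 0)); last first.
  by apply/funext => u; rewrite summxE.
by apply: cont_bigsum => j; apply: h.
Qed.

Lemma cont_pinner (T : topologicalType) (z w : T -> 'cV[R]_n) t :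
  vcont z t -> vcont w t ->
  {for t, continuous (fun t => pinner s (z t) (w t))}.
Proof.
move=> hz hw.
rewrite (_ : (fun t => _) = (fun t => \sum_i Jmx R s n i i * (z t i 0 * w t i 0))).
  apply: cont_bigsum => i; apply: cvgM; first exact: cvg_cst.
  by apply: cvgM; [exact: hz | exact: hw].
by apply/funext => u; rewrite pinnerE.
Qed.

Lemma vcontP (T : topologicalType) (z : T -> 'cV[R]_n) t : vcont z t -> {for t, continuous z}.
Proof.
move=> h; apply/cvg_ballP => e e0.
have : \forall u \near t, forall i, ball (z t i 0) e (z u i 0).
  refine (@filter_forall T 'I_n (fun i a => ball (z t i 0) e (z a i 0)) (nbhs t) _ _) => i.
  by have /cvg_ballP := h i; apply.
apply: filterS => u hu; split=> // i j.
by rewrite (ord1 j); apply: hu.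
Qed.

Lemma vcont_id v : vcont (fun x : 'cV[R]_n => x) v.
Proof. by move=> i; exact: coord_continuous. Qed.

End VectorCurves.

(** With [q] and [g] the values at [y] of the pseudo-norm and of [csum], and
    [rho ^+ 2 = g / g0], the conclusion says that [y + be *: cnormal y] lies in
    the cone [csum = g0 * q ^+ 2]. It is a quadratic equation for [be]; this
    form of the root vanishes with [rho - q] and stays regular when the leading
    coefficient does. *)
Lemma normal_correction (R : rcfType) (q g rho : R) :
  let B := rho * q - g in let k := (rho - q) / B in
  let be := - k / (1 + Num.sqrt (1 - g * k ^+ 2)) in
  B != 0 -> 0 <= 1 - g * k ^+ 2 ->
  rho * (1 + 2 * be * q + be ^+ 2 * g) = q + 2 * be * g + be ^+ 2 * (g * q).
Proof.
move=> B k be B0 k0; pose S := Num.sqrt (1 - g * k ^+ 2).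
have S2 : S ^+ 2 = 1 - g * k ^+ 2 by rewrite sqr_sqrtr.
have S1 : 1 + S != 0 by rewrite gt_eqF // ltr_pwDl // sqrtr_ge0.
have beE : be * (1 + S) = - k by rewrite /be divfK.
have kB : k * B = rho - q by rewrite /k divfK.
apply/eqP; rewrite -subr_eq0; apply/eqP.
have -> : rho * (1 + 2 * be * q + be ^+ 2 * g) - (q + 2 * be * g + be ^+ 2 * (g * q))
  = (rho - q) * (1 + g * be ^+ 2) + 2 * be * B by rewrite /B; ring.
apply: (mulIf (mulf_neq0 S1 S1)); rewrite mul0r.
have -> : ((rho - q) * (1 + g * be ^+ 2) + 2 * be * B) * ((1 + S) * (1 + S))
  = (rho - q) * ((1 + S) ^+ 2 + g * (be * (1 + S)) ^+ 2) + 2 * (be * (1 + S)) * (1 + S) * B.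
  by ring.
rewrite beE -kB.
transitivity (k * B * (S ^+ 2 - (1 - g * k ^+ 2))); first by ring.
by rewrite S2 subrr mulr0.
Qed.

Section LevelCurve.
Variables (R : realType) (n s m r : nat) (P : 'I_m -> 'M[R]_n).
Hypothesis hP : clifford_system s r P.
Variable g0 : R.
Hypotheses (g00 : g0 != 0) (g01 : g0 != 1).
Implicit Types (x u v w : 'cV[R]_n) (z : R -> 'cV[R]_n).
Local Notation ip := (pinner s).
Local Notation csum := (csum s r P).
Local Notation cnormal := (cnormal s r P).
Local Notation eta := (csign R r).

Lemma vder_line x v : vder (fun t => x + t *: v) v.
Proof.
move=> i; rewrite (_ : (fun _ => _) = (fun t => x i 0 + t * v i 0)); last first.
  by apply/funext => t; rewrite !mxE.
have h : is_derive (0 : R) 1 (fun t : R => t * v i 0) (1 * v i 0 + 0 * 0).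
  exact: (is_derive_prod (is_derive_id _ _) (is_derive_cst _ _ _)).
by apply: is_derive_eq (is_deriveD (is_derive_cst (x i 0) _ _) h) _; rewrite mul1r mul0r addr0 add0r.
Qed.

Lemma vcont_line x v (t : R) : vcont (fun t : R => x + t *: v) t.
Proof.
apply: vcontD; first by move=> i; exact: cvg_cst.
by apply: vcontZ; [exact: cvg_id | move=> i; exact: cvg_cst].
Qed.

Lemma is_derive_cquad z v k : vder z v ->
  is_derive (0 : R) 1 (fun t => cquad s P k (z t)) (2 * ip (P k *m z 0) v).
Proof.
move=> h; apply: is_derive_eq (is_derive_pinner s (vderM (P k) h) h) _.
by rewrite /= (cliff_sym hP k v) [ip v _]pinnerC mulr_natl mulr2n.
Qed.

Lemma is_derive_csum z v : vder z v ->
  is_derive (0 : R) 1 (fun t => csum (z t)) (4 * ip (cnormal (z 0)) v).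
Proof.
move=> h; rewrite /cnormal /cmx mulmx_suml pinner_suml mulr_sumr.
apply: is_derive_bigsum => j; have hj := is_derive_cquad j h.
rewrite (_ : (fun _ => _) = (fun t => eta j * (cquad s P j (z t) * cquad s P j (z t)))) //.
apply: is_derive_eq (is_derive_prod (is_derive_cst (eta j) _ _) (is_derive_prod hj hj)) _.
by rewrite -scalemxAl pinnerZl mul0r add0r /cst; ring.
Qed.

Lemma vder_cnormal z v : vder z v -> vder (fun t => cnormal (z t))
  (\sum_j (2 * eta j * ip (P j *m z 0) v) *: (P j *m z 0) + cmx s r P (z 0) *m v).
Proof.
move=> h.
rewrite (_ : (fun _ => _)
  = (fun t => \sum_j (eta j * cquad s P j (z t)) *: (P j *m z t))); last first.
  apply/funext => t; rewrite /cnormal /cmx mulmx_suml.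
  by apply: eq_bigr => j _; rewrite -scalemxAl.
rewrite /cmx mulmx_suml -big_split; apply: vder_sum => j /=.
have e := is_derive_prod (is_derive_cst (eta j) (0 : R) 1) (is_derive_cquad j h).
have := vderZ e (vderM (P j) h); rewrite /cst mul0r add0r mulrCA mulrA.
by rewrite -scalemxAl.
Qed.

Lemma cont_csum (T : topologicalType) (z : T -> 'cV[R]_n) t :
  vcont z t -> {for t, continuous (fun t => csum (z t))}.
Proof.
move=> h; apply: cont_bigsum => j.
rewrite (_ : (fun _ => _) = (fun t => eta j * (cquad s P j (z t) * cquad s P j (z t)))) //.
have hj : {for t, continuous (fun t => cquad s P j (z t))}.
  by apply: cont_pinner => //; apply: vcontM.
by apply: cvgM; [exact: cvg_cst | exact: cvgM].
Qed.

Lemma vcont_cnormal (T : topologicalType) (z : T -> 'cV[R]_n) t :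
  vcont z t -> vcont (fun t => cnormal (z t)) t.
Proof.
move=> h.
rewrite (_ : (fun _ => _)
  = (fun t => \sum_j (eta j * cquad s P j (z t)) *: (P j *m z t))); last first.
  apply/funext => a; rewrite /cnormal /cmx mulmx_suml.
  by apply: eq_bigr => j _; rewrite -scalemxAl.
apply: vcont_sum => j; apply: vcontZ; last exact: vcontM.
apply: cvgM; first exact: cvg_cst.
have c : vcont (fun t => P j *m z t) t by apply: vcontM.
exact: (cont_pinner c h).
Qed.

Definition unit_level : set 'cV[R]_n := [set x | ip x x = 1 /\ csum x = g0].

(** The open cone over a subset of the pseudo-sphere. *)
Definition cone (L : set 'cV[R]_n) : set 'cV[R]_n :=
  [set z | 0 < ip z z /\ L ((Num.sqrt (ip z z))^-1 *: z)].

(** Pushing the line [x + t *: v] along the normal planes back to the cone over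
    the level set gives, after normalization, a continuous curve through [x];
    so it does not leave the component of [x]. In a tangential direction [v]
    the correction [be] vanishes to first order. The last two conditions ensure
    that the pushed point spans with its normal vector a plane containing
    [x + t *: v]. *)
Lemma level_curve x v : unit_level x ->
  exists be : R -> R, [/\ be 0 = 0,
    ip x v = 0 -> ip (cnormal x) v = 0 -> is_derive (0 : R) 1 be 0 &
    \forall t \near (0 : R), let y := x + t *: v in
      [/\ cone (connected_component unit_level x) (y + be t *: cnormal y),
          plane_scale s r P 1 (be t) y != 0 & 1 - be t ^+ 2 * csum y != 0]].
Proof.
move=> [qx gx].
pose y t := x + t *: v; pose q t := ip (y t) (y t); pose g t := csum (y t).
pose rho t := Num.sqrt (g t / g0).
pose B t := rho t * q t - g t; pose k t := (rho t - q t) / B t.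
pose be t := - k t / (1 + Num.sqrt (1 - g t * k t ^+ 2)).
pose z t := y t + be t *: cnormal (y t); pose N t := ip (z t) (z t).
have y0 : y 0 = x by rewrite /y scale0r addr0.
have q0 : q 0 = 1 by rewrite /q y0.
have gz : g 0 = g0 by rewrite /g y0.
have rho0 : rho 0 = 1 by rewrite /rho gz divff // sqrtr1.
have B0 : B 0 != 0 by rewrite /B rho0 q0 gz mul1r subr_eq0 eq_sym.
have k0 : k 0 = 0 by rewrite /k rho0 q0 subrr mul0r.
have be0 : be 0 = 0 by rewrite /be k0 oppr0 mul0r.
have z0 : z 0 = x by rewrite /z be0 scale0r addr0.
have N0 : N 0 = 1 by rewrite /N z0.
have cy t : vcont y t by apply: vcont_line.
have cq t : {for t, continuous q} by apply: cont_pinner.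
have cg t : {for t, continuous g} by apply: cont_csum.
have crho t : {for t, continuous rho}.
  apply: (@continuous_comp _ _ _ (fun t => g t / g0) Num.sqrt).
    by apply: cvgM; [exact: cg | exact: cvg_cst].
  exact: sqrt_continuous.
have cB t : {for t, continuous B}.
  by apply: cvgB; [apply: cvgM; [exact: crho | exact: cq] | exact: cg].
have ck t : B t != 0 -> {for t, continuous k}.
  move=> Bt; apply: cvgM; first by apply: cvgB; [exact: crho | exact: cq].
  by apply: cvgV => //; exact: cB.
have cs t : B t != 0 -> {for t, continuous (fun t => 1 - g t * k t ^+ 2)}.
  move=> /ck ckt; rewrite (_ : (fun _ => _) = (fun t => 1 - g t * (k t * k t))) //.
  apply: cvgB; first exact: cvg_cst.
  by apply: cvgM; [exact: cg | exact: cvgM].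
have cE t : B t != 0 -> {for t, continuous (fun t => (1 + Num.sqrt (1 - g t * k t ^+ 2))^-1)}.
  move=> Bt; apply: cvgV; first by rewrite gt_eqF // ltr_pwDl // sqrtr_ge0.
  apply: cvgD; first exact: cvg_cst.
  apply: (@continuous_comp _ _ _ (fun t => 1 - g t * k t ^+ 2) Num.sqrt); first exact: cs.
  exact: sqrt_continuous.
have cbe t : B t != 0 -> {for t, continuous be}.
  by move=> Bt; apply: cvgM; [apply: cvgN; exact: ck | exact: cE].
have cz t : B t != 0 -> vcont z t.
  move=> Bt; apply: vcontD => //; apply: vcontZ; first exact: cbe.
  exact: vcont_cnormal.
have cN t : B t != 0 -> {for t, continuous N} by move=> Bt; apply: cont_pinner; exact: cz.
have nB : \forall t \near (0 : R), B t != 0.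
  have cB0 : B @ (0 : R) --> B 0 by exact: cB.
  exact: (cvgr_neq0 _ cB0 B0).
have ng : \forall t \near (0 : R), 0 < g t / g0.
  have c : (fun t => g t / g0) @ (0 : R) --> g 0 / g0.
    by apply: cvgM; [exact: cg | exact: cvg_cst].
  by apply: (cvgr_gt _ c); rewrite gz divff.
exists be; split=> //.
  move=> xv nv.
  have dq : is_derive (0 : R) 1 (fun t => q t - 1) 0.
    have h := is_derive_pinner s (vder_line x v) (vder_line x v).
    apply: (is_derive_eq (is_deriveB h (is_derive_cst (1 : R) _ _))).
    by rewrite /= scale0r addr0 [ip v x]pinnerC xv subr0 addr0.
  have dg : is_derive (0 : R) 1 (fun t => g t - g0) 0.
    have h := is_derive_csum (vder_line x v).
    apply: (is_derive_eq (is_deriveB h (is_derive_cst g0 _ _))).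
    by rewrite /= scale0r addr0 nv mulr0 subr0.
  have rho1 t : rho t + 1 != 0 by rewrite gt_eqF // ltr_wpDl // sqrtr_ge0.
  have dr : is_derive (0 : R) 1 (fun t => (g t - g0) * (g0 * (rho t + 1))^-1) 0.
    apply: is_derive_eq (is_derive_vanish _ dg _) _; last by rewrite mul0r.
      by rewrite gz subrr.
    apply: cvgV; first by rewrite mulf_neq0.
    apply: cvgM; first exact: cvg_cst.
    by apply: cvgD; [exact: crho | exact: cvg_cst].
  have dC := is_deriveB dq dr.
  have dE : is_derive (0 : R) 1 (fun t => ((q t - 1) - (g t - g0) * (g0 * (rho t + 1))^-1)
      * ((B t)^-1 * (1 + Num.sqrt (1 - g t * k t ^+ 2))^-1)) 0.
    apply: is_derive_eq (is_derive_vanish _ dC _) _.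
    - suff : q 0 - 1 - (g 0 - g0) * (g0 * (rho 0 + 1))^-1 = 0 by [].
      by rewrite q0 gz !subrr mul0r subr0.
    - by apply: cvgM; [apply: cvgV => //; exact: cB | exact: cE].
    - by rewrite subr0 mul0r.
  apply: near_eq_is_derive dE; near=> t.
  have gt : 0 < g t / g0 by near: t.
  have gr : g t = g0 * rho t ^+ 2 by rewrite sqr_sqrtr ?(ltW gt) // mulrC divfK.
  rewrite /be /k -[- (_ / B t)]mulNr -[RHS]mulrA; congr (_ * _).
  (* Writing [rho - 1] as a multiple of [g - g0] avoids differentiating the
     square root. *)
  rewrite opprB gr (_ : g0 * rho t ^+ 2 - g0 = (rho t - 1) * (g0 * (rho t + 1))).
    by rewrite mulfK ?mulf_neq0 //; ring.
  by ring.
have ns : \forall t \near (0 : R), 0 < 1 - g t * k t ^+ 2.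
  by apply: (cvgr_gt _ (cs _ B0)); rewrite k0 expr0n mulr0 subr0.
have nN : \forall t \near (0 : R), 0 < N t by apply: (cvgr_gt _ (cN _ B0)); rewrite N0.
have nP : \forall t \near (0 : R), plane_scale s r P 1 (be t) (y t) != 0.
  have c : (fun t => plane_scale s r P 1 (be t) (y t)) @ (0 : R) -->
      plane_scale s r P 1 (be 0) (y 0).
    rewrite /plane_scale; apply: cvgD.
      apply: cvgD; first exact: cvg_cst.
      apply: cvgM; last exact: cq.
      by apply: cvgM; [exact: cvg_cst | exact: cbe].
    by apply: cvgM; [apply: cvgM; exact: cbe | exact: cg].
  apply: (cvgr_neq0 _ c); rewrite /plane_scale be0 mulr0 mul0r !expr2 !mul0r.
  by rewrite mul1r !addr0 oner_neq0.
have nC : \forall t \near (0 : R), 1 - be t ^+ 2 * g t != 0.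
  have c : (fun t => 1 - be t ^+ 2 * g t) @ (0 : R) --> 1 - be 0 ^+ 2 * g 0.
    apply: cvgB; first exact: cvg_cst.
    by apply: cvgM; [apply: cvgM; exact: cbe | exact: cg].
  by apply: (cvgr_neq0 _ c); rewrite be0 expr2 !mul0r subr0 oner_neq0.
have good : \forall t \near (0 : R), [/\ B t != 0, 0 < g t / g0, 0 < 1 - g t * k t ^+ 2 & 0 < N t].
  by near=> t; split; near: t.
have lev t : [/\ B t != 0, 0 < g t / g0, 0 < 1 - g t * k t ^+ 2 & 0 < N t] ->
    unit_level ((Num.sqrt (N t))^-1 *: z t).
  move=> [Bt gt st Nt].
  have NN : Num.sqrt (N t) ^+ 2 = N t by rewrite sqr_sqrtr // ltW.
  split; first by rewrite pinnerZl pinnerZr mulrA -expr2 exprVn NN mulVf // gt_eqF.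
  rewrite csumZ exprVn (_ : 4 = 2 * 2)%N // exprM NN.
  have -> : csum (z t) = g0 * N t ^+ 2.
    have zE : z t = 1 *: y t + be t *: cnormal (y t) by rewrite scale1r.
    rewrite /N zE (csum_plane hP) (pinner_plane hP) -/(q t) -/(g t).
    have gr : g t = g0 * rho t ^+ 2 by rewrite sqr_sqrtr ?(ltW gt) // mulrC divfK.
    have e : rho t * plane_scale s r P 1 (be t) (y t) =
        1 ^+ 2 * q t + 2 * 1 * be t * g t + be t ^+ 2 * (g t * q t).
      have := normal_correction Bt (ltW st); rewrite -/(be t) /plane_scale => h.
      by rewrite -/(q t) -/(g t) expr1n mulr1 mul1r h.
    by rewrite -e exprMn [in LHS]gr mulrC -mulrA.
  by rewrite mulrCA mulVf ?mulr1 // expf_neq0 // gt_eqF.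
have /nbhs_ballP[e /= e0 he] := good.
pose f t := (Num.sqrt (N t))^-1 *: z t.
have fI t : `|t| < e -> connected_component unit_level x (f t).
  move=> te; apply: (@connected_component_max _ _ (f @` ball (0 : R) e)).
  - by exists 0; [exact: ballxx | rewrite /f N0 sqrtr1 invr1 scale1r z0].
  - by move=> _ [a ha <-]; apply/lev/he.
  - apply: connected_continuous_connected.
      apply/connected_intervalP => a b; rewrite /ball /= !sub0r !normrN !ltr_norml.
      move=> /andP[ha _] /andP[_ hb] d /andP[ad db].
      by rewrite sub0r normrN ltr_norml (lt_le_trans ha ad) (le_lt_trans db hb).
    apply: continuous_in_subspaceT => a /set_mem /he [Ba _ _ Na].
    apply: vcontP; apply: vcontZ; last exact: cz.
    apply: cvgV; first by rewrite gt_eqF // sqrtr_gt0.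
    apply: (@continuous_comp _ _ _ N Num.sqrt); first exact: cN.
    exact: sqrt_continuous.
  - by exists t => //; rewrite /ball /= sub0r normrN.
have nf : \forall t \near (0 : R), connected_component unit_level x (f t).
  apply/nbhs_ballP; exists e => // t; rewrite /ball /= sub0r normrN; exact: fI.
near=> t; split; [split | |]; near: t => //.
Unshelve. all: by end_near. Qed.

End LevelCurve.

Lemma two_values (T : topologicalType) (R : realType) (L : set T) (f : T -> R) (a b : R) x0 :
  connected L -> {in L, continuous f} -> (forall x, L x -> f x = a \/ f x = b) ->
  L x0 -> f x0 = a -> forall x, L x -> f x = a.
Proof.
move=> cL cf fab Lx0 fx0 x Lx; case: (fab x Lx) => // fxb.
have [//|ab] := eqVneq a b; first by rewrite fxb.
exfalso.
have /connected_intervalP itv : connected (f @` L).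
  by apply: connected_continuous_connected => //; apply: continuous_in_subspaceT.
have Ia : (f @` L) a by exists x0.
have Ib : (f @` L) b by exists x.
have [y Ly] : (f @` L) ((a + b) / 2).
  by have [ab'|ab'|ab'] := ltgtP a b; [apply: (itv a b) | apply: (itv b a) | rewrite ab' eqxx in ab] => //; lra.
by have := fab y Ly; case=> -> => h; move/eqP: ab; apply; lra.
Qed.

Section Component.
Variables (R : realType) (n s m r : nat) (P : 'I_m -> 'M[R]_n).
Hypothesis hP : clifford_system s r P.
Variable g0 : R.
Hypotheses (g00 : g0 != 0) (g01 : g0 != 1).
Implicit Types (x y u v w : 'cV[R]_n) (z : R -> 'cV[R]_n).
Local Notation ip := (pinner s).
Local Notation csum := (csum s r P).
Local Notation cnormal := (cnormal s r P).
Local Notation eta := (csign R r).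
Local Notation M := (unit_level s r P g0).

Variable L : set 'cV[R]_n.
Hypothesis hL : is_component M L.

Lemma comp_connected : connected L.
Proof. by have [x _ ->] := hL; apply: component_connected. Qed.

Lemma comp_level x : L x -> M x.
Proof. by have [y _ ->] := hL; apply: connected_component_sub. Qed.

Lemma compE x : L x -> L = connected_component M x.
Proof. by have [y My ->] := hL => h; apply: same_connected_component. Qed.

Lemma cone_comp y : cone s L y -> exists a x, [/\ 0 < a, L x & y = a *: x].
Proof.
move=> [y0 Ly]; exists (Num.sqrt (ip y y)), ((Num.sqrt (ip y y))^-1 *: y); split=> //.
  by rewrite sqrtr_gt0.
by rewrite scalerA divff ?scale1r // gt_eqF // sqrtr_gt0.
Qed.

Lemma near_comp x v : L x -> exists be : R -> R, [/\ be 0 = 0,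
    ip x v = 0 -> ip (cnormal x) v = 0 -> is_derive (0 : R) 1 be 0 &
    \forall t \near (0 : R), let y := x + t *: v in
      [/\ cone s L (y + be t *: cnormal y),
          plane_scale s r P 1 (be t) y != 0 & 1 - be t ^+ 2 * csum y != 0]].
Proof.
move=> Lx; have [be [be0 dbe nbe]] := level_curve hP g00 g01 v (comp_level Lx).
by exists be; split=> //; apply: filterS nbe => t /=; rewrite -(compE Lx).
Qed.

(** Identities that hold along [L] may be differentiated in the tangent
    directions; a function [F] given on the cone avoids the normalization of
    curves. *)
Lemma tangent_derive x v (F : 'cV[R]_n -> R) (d : R) :
  L x -> ip x v = 0 -> ip (cnormal x) v = 0 ->
  (forall y, cone s L y -> F y = 0) ->
  (forall z, z 0 = x -> vder z v -> is_derive (0 : R) 1 (fun t => F (z t)) d) ->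
  d = 0.
Proof.
move=> Lx xv nv F0 dF; have [be [be0 /(_ xv nv) dbe nbe]] := near_comp v Lx.
pose z t := x + t *: v + be t *: cnormal (x + t *: v).
have z0 : z 0 = x by rewrite /z be0 !scale0r !addr0.
have vz : vder z v.
  rewrite -[v]addr0; apply: vderD; first exact: vder_line.
  move=> i; rewrite mxE (_ : (fun _ => _) = (fun t => be t * cnormal (x + t *: v) i 0)).
    apply: is_derive_eq (is_derive_vanish be0 dbe _) _; last by rewrite mul0r.
    have := @vcont_cnormal R n s m r P R (fun t => x + t *: v) 0 (@vcont_line R n x v 0) i.
    by [].

  by apply/funext => t; rewrite mxE.
have /near_eq_is_derive h : \forall t \near (0 : R), F (z t) = cst 0 t.
  by apply: filterS nbe => t /= [/F0 ->].
by have [_ <-] := h _ _ (dF z z0 vz); rewrite derive_cst.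
Qed.

(** The Gram matrix of [x] and [cnormal x] has determinant [g0 * (1 - g0)], so
    the normal plane is non-degenerate and is its own double orthogonal. *)
Lemma normal_plane_span x u : M x ->
  (forall v, ip x v = 0 -> ip (cnormal x) v = 0 -> ip u v = 0) ->
  let b := (ip u (cnormal x) - g0 * ip u x) / (g0 * (1 - g0)) in
  u = (ip u x - b * g0) *: x + b *: cnormal x.
Proof.
move=> [qx gx] hu b; set a := ip u x - _.
have g1 : g0 * (1 - g0) != 0 by rewrite mulf_neq0 // subr_eq0 eq_sym.
have nx : ip (cnormal x) x = g0 by rewrite pinner_cnormal.
have xn : ip x (cnormal x) = g0 by rewrite pinnerC.
have nn : ip (cnormal x) (cnormal x) = g0 by rewrite (pinner_cnormal2 hP) gx qx mulr1.
have bE : b * (g0 * (1 - g0)) = ip u (cnormal x) - g0 * ip u x by rewrite /b divfK.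
pose d := u - (a *: x + b *: cnormal x).
suff d0 : d = 0 by apply/eqP; rewrite -subr_eq0 -/d d0.
have dx : ip d x = 0 by rewrite /d !pinner_lin nx qx /a; ring.
have dn : ip d (cnormal x) = 0.
  by rewrite /d !pinner_lin nn xn /a; lra.
apply: (@pinner_nondeg _ _ s) => w.
pose c := (ip w (cnormal x) - g0 * ip w x) / (g0 * (1 - g0)).
have cE : c * (g0 * (1 - g0)) = ip w (cnormal x) - g0 * ip w x by rewrite /c divfK.
pose e := ip w x - c * g0.
pose w' := w - (e *: x + c *: cnormal x).
have xw : ip x w' = 0 by rewrite pinnerC /w' !pinner_lin nx qx /e; ring.
have nw : ip (cnormal x) w' = 0.
  by rewrite pinnerC /w' !pinner_lin nn xn /e; lra.
have -> : w = w' + (e *: x + c *: cnormal x) by rewrite subrK.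
rewrite (pinnerDr s d w') (pinnerDr s d (e *: x)) !pinnerZr dx dn !mulr0 !addr0 /d.
by rewrite pinnerDl pinnerNl pinnerDl !pinnerZl xw nw hu // !mulr0 addr0 subr0.
Qed.

End Component.

(** * Two Clifford systems with a common level set *)

Section OtherSystem.
Variables (R : realType) (n s m r : nat) (P P' : 'I_m -> 'M[R]_n).
Hypotheses (hP : clifford_system s r P) (hP' : clifford_system s r P').
Variable g0 : R.
Hypotheses (g00 : g0 != 0) (g01 : g0 != 1).
Implicit Types (x y u v w : 'cV[R]_n) (z : R -> 'cV[R]_n).
Local Notation ip := (pinner s).
Local Notation eta := (csign R r).
Local Notation csum' := (csum s r P').
Local Notation csum := (csum s r P).
Local Notation cnormal' := (cnormal s r P').
Local Notation cnormal := (cnormal s r P).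
Variable L : set 'cV[R]_n.
Hypothesis hL : is_component (unit_level s r P g0) L.
Hypothesis L' : forall x, L x -> csum' x = g0.

(** Both normal vectors have the same products with [x] and with themselves,
    and only two vectors of the normal plane satisfy this. *)
Lemma normal_dichotomy x : L x ->
  cnormal' x = cnormal x \/ cnormal' x = (2 * g0) *: x - cnormal x.
Proof.
move=> Lx; have [qx gx] := comp_level hL Lx; have g'x := L' Lx.
have tg v : ip x v = 0 -> ip (cnormal x) v = 0 -> ip (cnormal' x) v = 0.
  move=> xv nv.
  suff : 4 * ip (cnormal' x) v = 0.
    by move/eqP; rewrite mulf_eq0 pnatr_eq0 /= => /eqP.
  apply: (tangent_derive hP g00 g01 hL (F := fun y => csum' y - g0 * (ip y y * ip y y)) Lx xv nv).
    move=> y /cone_comp[a [y1 [a0 Ly ->]]]; rewrite csumZ L' // !pinner_lin.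
    by have [-> _] := comp_level hL Ly; ring.
  move=> z z0 vz; have dq := is_derive_pinner s vz vz.
  have := is_deriveB (is_derive_csum hP' vz)
    (is_derive_prod (is_derive_cst g0 (0 : R) 1) (is_derive_prod dq dq)).
  move=> h; apply: (is_derive_eq h); rewrite z0 [ip v x]pinnerC xv.
  by rewrite !(addr0, mul0r, mulr0, subr0).
have := normal_plane_span hP g00 g01 (conj qx gx) tg; move=> /=; set b := _ / _.
have -> : ip (cnormal' x) x = g0 by rewrite pinner_cnormal.
move=> nE; have := pinner_cnormal2 hP' x; rewrite g'x qx nE !pinner_lin.
rewrite [ip x (cnormal x)]pinnerC pinner_cnormal (pinner_cnormal2 hP) gx qx => h.
have : (b - 1) * (b + 1) * (g0 * (1 - g0)) = 0 by nra.
move/eqP; rewrite !mulf_eq0 (negbTE g00) subr_eq0 subr_eq0 (eq_sym 1) (negbTE g01) !orbF.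
case/orP; [move/eqP => -> | rewrite addr_eq0 => /eqP ->]; [left | right].
  by rewrite mul1r subrr scale0r scale1r add0r.
by rewrite mulN1r opprK scaleN1r; congr (_ *: _ - _); ring.
Qed.

(** The inner product of the two normal vectors tells the alternatives apart:
    it is [g0] in one case and [2 * g0 ^+ 2 - g0] in the other. *)
Lemma normal_constant x0 : L x0 -> cnormal' x0 = cnormal x0 ->
  forall x, L x -> cnormal' x = cnormal x.
Proof.
move=> Lx0 nx0 x Lx.
have nn y : L y -> ip (cnormal y) (cnormal y) = g0.
  by move=> Ly; have [qy gy] := comp_level hL Ly; rewrite (pinner_cnormal2 hP) qy gy mulr1.
have := @two_values _ R L (fun y => ip (cnormal' y) (cnormal y)) g0 (2 * g0 ^+ 2 - g0) x0.
move=> /(_ _ _ _ Lx0 _ x Lx) h.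
have [//|fl] := normal_dichotomy Lx; exfalso.
have : ip (cnormal' x) (cnormal x) = g0.
  apply: h; [exact: comp_connected hL | | | by rewrite nx0 nn].
    move=> y _; apply: cont_pinner; apply: vcont_cnormal; exact: vcont_id.
  move=> y Ly; have [->|->] := normal_dichotomy Ly; first by left; rewrite nn.
  right; have [qy gy] := comp_level hL Ly.
  by rewrite pinnerDl pinnerNl nn // pinnerZl pinnerC pinner_cnormal gy; ring.
have [qx gx] := comp_level hL Lx.
rewrite fl pinnerDl pinnerNl nn // pinnerZl pinnerC pinner_cnormal gx => e.
have : g0 * (1 - g0) = 0 by lra.
by move/eqP; rewrite mulf_eq0 (negbTE g00) subr_eq0 eq_sym (negbTE g01).
Qed.

(** Near a point of [L] every point lies in a normal plane of the cone over [L].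
    On these planes the values of the quartic forms only depend on the point of
    the cone and on its normal vector, so the two forms agree. *)
Lemma normal_csum x : L x -> (forall y, L y -> cnormal' y = cnormal y) ->
  forall v, csum' v = csum v.
Proof.
move=> Lx nE v; have [be [_ _ nbe]] := near_comp hP g00 g01 hL v Lx.
have loc : \forall t \near (0 : R), csum' (x + t *: v) = csum (x + t *: v).
  apply: filterS nbe => t /=; set y := x + t *: v; set b := be t.
  set z := y + b *: cnormal y; case=> cz k0 b0.
  have [a [z1 [_ Lz zE]]] := cone_comp cz.
  have nz : cnormal' z = cnormal z by rewrite zE !cnormalZ nE.
  have gz : csum' z = csum z.
    by rewrite zE !csumZ L' //; have [_ ->] := comp_level hL Lz.
  set k := plane_scale s r P 1 b y in k0.
  have yE : (k * (1 - b ^+ 2 * csum y)) *: y = k *: z + (- b) *: cnormal z.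
    have zE' : z = 1 *: y + b *: cnormal y by rewrite scale1r.
    rewrite {2}zE' (cnormal_plane hP) -/k scale1r /z.
    by apply/colP => i; rewrite !mxE; ring.
  have : csum' ((k * (1 - b ^+ 2 * csum y)) *: y) = csum ((k * (1 - b ^+ 2 * csum y)) *: y).
    by rewrite yE -{1}nz (csum_plane hP') (csum_plane hP) /plane_scale gz.
  rewrite !csumZ; apply: mulfI; rewrite expf_neq0 // mulf_neq0 //.
have /nbhs_ballP[e /= e0 he] := loc.
have hel a : `|a| < e -> csum' (x + a *: v) = csum (x + a *: v).
  by move=> ae; apply: he; rewrite /ball /= sub0r normrN.
(* The step [t] keeps the four points [x + k * t *: v] inside the interval. *)
pose t := e / 8.
have t0 : 0 < t by rewrite /t; lra.
have small k : (0 <= k <= 4) -> `|k * t| < e.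
  by move=> /andP[k0 k4]; rewrite ger0_norm ?mulr_ge0 ?(ltW t0) // /t; nra.
have c0 : 24 * t ^+ 4 != 0 by rewrite mulf_neq0 ?pnatr_eq0 // expf_neq0 // gt_eqF.
apply: (mulfI c0); rewrite (csum_diff4 hP' x v t) (csum_diff4 hP x v t).
rewrite !hel //; last 4 first.
- by rewrite -[t]mul1r; apply: small; lra.
- by apply: small; lra.
- by apply: small; lra.
- by apply: small; lra.
by have := hel 0; rewrite scale0r addr0 normr0 => ->.
Qed.

End OtherSystem.

(** * The pseudoscalar is not constant on a component *)

Lemma mxtrace_anticomm (F : numFieldType) n (A B : 'M[F]_n) (e : F) :
  A *m A = e%:M -> e != 0 -> A *m B = - (B *m A) -> \tr B = 0.
Proof.
move=> AA e0 AB.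
have eB : e * \tr B = \tr (A *m A *m B) by rewrite AA mul_scalar_mx mxtraceZ.
have h : e * \tr B = - (e * \tr B).
  by rewrite {1}eB -mulmxA AB mulmxN raddfN /= mxtrace_mulC -mulmxA mxtrace_mulC -eB.
have /eqP : e * \tr B *+ 2 = 0 by rewrite mulr2n {1}h addNr.
by rewrite mulrn_eq0 /= mulf_eq0 (negbTE e0) => /eqP.
Qed.

Lemma mxrank_le_constraints (F : fieldType) n k (E : 'M[F]_n) (N : 'M[F]_(k, n)) :
  (forall v : 'cV[F]_n, N *m v = 0 -> E *m v = 0) -> (\rank E <= k)%N.
Proof.
move=> h; have : (kermx N^T <= kermx E^T)%MS.
  apply/sub_kermxP/row_matrixP => i; rewrite row0 row_mul.
  set u := row i _; have uN : u *m N^T = 0 by rewrite /u -row_mul mulmx_ker row0.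
  by apply: trmx_inj; rewrite trmx_mul trmxK trmx0 h // -[N]trmxK -trmx_mul uN trmx0.
move/mxrankS; rewrite !mxrank_ker !mxrank_tr => le.
have := rank_leq_row N; have := rank_leq_col N; have := rank_leq_col E; lia.
Qed.

Section Nonconstant.
Variables (R : realType) (n s m r : nat) (P : 'I_m -> 'M[R]_n).
Hypothesis hP : clifford_system s r P.
Variable g0 : R.
Hypotheses (g00 : g0 != 0) (g01 : g0 != 1).
Hypotheses (m4 : (4 %| m)%N) (m0 : (0 < m)%N) (r2 : ~~ odd r) (rm : (r <= m)%N).
Hypothesis nm : (2 * m < n)%N.
Implicit Types (x y u v w : 'cV[R]_n) (z : R -> 'cV[R]_n).
Local Notation ip := (pinner s).
Local Notation eta := (csign R r).
Local Notation csum := (csum s r P).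
Local Notation cnormal := (cnormal s r P).
Local Notation cmx := (cmx s r P).
Local Notation S := (pscalar P).
Variable L : set 'cV[R]_n.
Hypothesis hL : is_component (unit_level s r P g0) L.

(** Constancy makes [S *m y] normal at each [y], and the derivative of this
    condition leaves [S + a *: cmx x - a%:M] with rank at most [m]; but up to a
    factor it is a projection of rank [n / 2]. *)
Lemma pscalar_nonconstant k x : L x -> (forall y, L y -> ip (S *m y) y = k) -> False.
Proof.
move=> Lx kE.
have SS := pscalar_sqr hP m4 r2 rm.
have Ssym u v : ip (S *m u) v = ip u (S *m v) by apply: (pscalar_sym hP m4).
have SM y : S *m cmx y = - (cmx y *m S).
  rewrite mulmx_sumr mulmx_suml -sumrN; apply: eq_bigr => j _.
  by rewrite -scalemxAl -scalemxAr -scalerN (pscalar_anti hP m4 m0) opprK.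
have g1 : 1 - g0 != 0 by rewrite subr_eq0 eq_sym.
pose a := k / (1 - g0).
have Sx y : L y -> S *m y = a *: (y - cnormal y).
  move=> Ly; have My := comp_level hL Ly; have [qy gy] := My.
  have tg v : ip y v = 0 -> ip (cnormal y) v = 0 -> ip (S *m y) v = 0.
    move=> yv nv; suff : ip (S *m y) v + ip (S *m y) v = 0 by move=> ?; lra.
    apply: (tangent_derive hP g00 g01 hL (F := fun w => ip (S *m w) w - k * ip w w) Ly yv nv).
      move=> w /cone_comp[b [y1 [_ Ly1 ->]]]; rewrite -scalemxAr !pinner_lin kE //.
      by have [-> _] := comp_level hL Ly1; ring.
    move=> z z0 vz; have := is_deriveB (is_derive_pinner s (vderM S vz) vz)
      (is_derive_prod (is_derive_cst k (0 : R) 1) (is_derive_pinner s vz vz)).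
    move=> h; apply: (is_derive_eq h); rewrite /= z0 [ip v y]pinnerC yv.
    by rewrite Ssym [ip v _]pinnerC !(addr0, mul0r, mulr0, subr0).
  have := normal_plane_span hP g00 g01 My tg; rewrite kE //=.
  have -> : ip (S *m y) (cnormal y) = 0.
    have : ip (S *m y) (cnormal y) = - ip (S *m y) (cnormal y).
      rewrite {1}Ssym {1}/cnormal mulmxA SM mulNmx pinnerNr -mulmxA.
      by rewrite -(cmx_sym hP) pinnerC.
    by move=> h; lra.
  move=> ->; rewrite scalerBr -scaleNr; congr (_ *: _ + _ *: _); rewrite /a; field.
    by rewrite g00 g1.
  by rewrite g00 g1.
have ak : a * k = 1.
  have [qx gx] := comp_level hL Lx.
  have : ip (S *m x) (S *m x) = 1 by rewrite Ssym mulmxA SS mul1mx qx.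
  rewrite Sx // !pinner_lin [ip x (cnormal x)]pinnerC pinner_cnormal.
  rewrite (pinner_cnormal2 hP) qx gx => e.
  by rewrite -e -[X in a * X](divfK g1) -/a; ring.
have a0 : a != 0 by apply/eqP => e; move: ak; rewrite e mul0r => /eqP; rewrite eq_sym oner_eq0.
have Sv v : (forall j, ip (P j *m x) v = 0) -> ip x v = 0 ->
    S *m v = a *: (v - cmx x *m v).
  move=> Pv xv.
  have nv : ip (cnormal x) v = 0.
    rewrite /cnormal /cmx mulmx_suml pinner_suml big1 // => j _.
    by rewrite -scalemxAl pinnerZl Pv mulr0.
  apply/eqP; rewrite -subr_eq0; apply/eqP; apply: (@pinner_nondeg _ _ s) => u.
  pose F y := ip y y * ip (S *m y) u - a * (ip y y * ip y u - ip (cnormal y) u).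
  apply: (tangent_derive hP g00 g01 hL (F := F) Lx xv nv).
    move=> w /cone_comp[b [y1 [_ Ly1 ->]]]; rewrite /F -scalemxAr cnormalZ Sx //.
    by have [q1 _] := comp_level hL Ly1; rewrite !pinner_lin q1; ring.
  move=> z z0 vz; have dq := is_derive_pinner s vz vz.
  have du : vder (fun=> u) (0 : 'cV[R]_n) by move=> i; rewrite mxE; exact: is_derive_cst.
  have d1 := is_derive_prod dq (is_derive_pinner s (vderM S vz) du).
  have d2 := is_derive_prod dq (is_derive_pinner s vz du).
  have d3 := is_derive_pinner s (vder_cnormal hP vz) du.
  have d4 := is_derive_prod (is_derive_cst a (0 : R) 1) (is_deriveB d2 d3).
  apply: (is_derive_eq (is_deriveB d1 d4)); rewrite /= z0.
  have p0 w : ip w 0 = 0 by rewrite -(scale0r 0) pinnerZr mul0r.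
  have [qx _] := comp_level hL Lx.
  rewrite big1 => [|j _]; last by rewrite Pv mulr0 scale0r.
  rewrite !p0 add0r [ip v x]pinnerC xv qx !pinner_lin /cst; ring.
have aa : 1 + a * a * g0 = a * a.
  have : a * (a * (1 - g0)) = 1 by rewrite {2}/a divfK.
  by move=> e; lra.
pose T := S + a *: cmx x.
have TT : T *m T = (a * a)%:M.
  have [_ gx] := comp_level hL Lx.
  rewrite /T mulmxDl !mulmxDr SS -!scalemxAl -!scalemxAr SM (cmx_sqr hP) gx scalerN.
  by rewrite addrA subrK !scale_scalar_mx -raddfD /= mulrA aa.
pose E := 2^-1 *: (1%:M - a^-1 *: T).
have EE : E *m E = E.
  rewrite /E -scalemxAl -scalemxAr; congr (_ *: _).
  have -> : (1%:M - a^-1 *: T) *m (1%:M - a^-1 *: T) = 2 *: (1%:M - a^-1 *: T).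
    rewrite mulmxBl mul1mx mulmxBr mulmx1 -scalemxAl -scalemxAr scalerA TT.
    rewrite scale_scalar_mx (_ : _ * _ = 1); last by field.
    by rewrite opprB scaler_nat mulr2n.
  by rewrite scalerA mulVf ?pnatr_eq0 // scale1r.
have trE : \tr E = n%:R / 2.
  have trS : \tr S = 0.
    pose j := Ordinal m0; apply: (mxtrace_anticomm (cliff_sqr hP j)).
      by apply/eqP => e; have := csign_sqr R r j; rewrite e mulr0 => /esym/eqP; rewrite oner_eq0.
    exact: (pscalar_anti hP m4 m0).
  have trM : \tr (cmx x) = 0 by apply: (mxtrace_anticomm SS (oner_neq0 _)); exact: SM.
  rewrite /E /T mxtraceZ raddfB /= mxtrace1 mxtraceZ raddfD /= mxtraceZ trS trM.
  by rewrite mulr0 addr0 mulr0 subr0 mulrC.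
have rE : (\rank E <= m)%N.
  (* Subtracting [cquad j x *: x] accounts for the direction [x], which also
     lies in the kernel; otherwise the bound would be [m + 1]. *)
  pose N : 'M[R]_(m, n) :=
    \matrix_(j, i) ((P j *m x - cquad s P j x *: x)^T *m Jmx R s n) 0 i.
  have [qx gx] := comp_level hL Lx.
  apply: (mxrank_le_constraints (N := N)) => v Nv.
  have Pv j : ip (P j *m x) v = cquad s P j x * ip x v.
    apply/eqP; rewrite -subr_eq0 -pinnerZl -pinnerNl -pinnerDl; apply/eqP.
    have := congr1 (fun w : 'cV[R]_m => w j 0) Nv; rewrite !mxE => <-.
    by rewrite /pinner mxE; apply: eq_bigr => i _; rewrite [in RHS]mxE.
  pose v' := v - ip x v *: x.
  have Sv' : S *m v' = a *: (v' - cmx x *m v').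
    apply: Sv => [j|]; rewrite /v' pinnerDr pinnerNr pinnerZr.
      by rewrite Pv -/(cquad s P j x); ring.
    by rewrite qx mulr1 subrr.
  have vE : v = v' + ip x v *: x by rewrite subrK.
  have Svv : S *m v = a *: (v - cmx x *m v).
    rewrite vE; clearbody v'; rewrite !mulmxDr Sv' -!scalemxAr Sx // -/(cnormal x).
    by apply/colP => i; rewrite !mxE; ring.
  rewrite /E /T -scalemxAl mulmxBl mul1mx -scalemxAl mulmxDl Svv -scalemxAl.
  by rewrite -(scalerDr a) subrK scalerA mulVf // scale1r subrr scaler0.
have : (\rank E)%:R = n%:R / 2 :> R by rewrite -mxtrace_idem.
have : (2 * \rank E < n)%N by apply: leq_ltn_trans nm; rewrite leq_mul2l.
by rewrite -(ltr_nat R) natrM => + h; rewrite h mulrC divfK ?pnatr_eq0 // ltxx.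
Qed.

End Nonconstant.

(** * Isometries preserving a component *)

Section Conjugate.
Variables (R : realType) (n s m r : nat) (P : 'I_m -> 'M[R]_n).
Hypothesis hP : clifford_system s r P.
Variables A B : 'M[R]_n.
Hypotheses (AB : A *m B = 1%:M) (BA : B *m A = 1%:M).
Hypothesis Aiso : forall u v, pinner s (A *m u) (A *m v) = pinner s u v.

Definition conj_system k : 'M[R]_n := B *m P k *m A.

Lemma pinner_inv u v : pinner s (B *m u) v = pinner s u (A *m v).
Proof. by rewrite -Aiso mulmxA AB mul1mx. Qed.

Lemma conj_clifford : clifford_system s r conj_system.
Proof.
have cM i j : conj_system i *m conj_system j = B *m (P i *m P j) *m A.
  by rewrite /conj_system -!mulmxA (mulmxA A B) AB mul1mx.
split=> [k u v|i j]; last first.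
  rewrite !cM -mulmxDl -mulmxDr hP.2 -scalemxAr -scalemxAl.
  by rewrite mulmx1 BA.
rewrite /conj_system -!mulmxA pinner_inv (cliff_sym hP) [RHS]pinnerC pinner_inv.
by rewrite pinnerC.
Qed.

Lemma conj_cquad k x : cquad s conj_system k x = cquad s P k (A *m x).
Proof. by rewrite /cquad /conj_system -!mulmxA pinner_inv. Qed.

Lemma conj_csum x : csum s r conj_system x = csum s r P (A *m x).
Proof. by apply: eq_bigr => k _; rewrite conj_cquad. Qed.

Lemma conj_cnormal x : cnormal s r conj_system x = B *m cnormal s r P (A *m x).
Proof.
rewrite /cnormal /cmx !mulmx_suml mulmx_sumr; apply: eq_bigr => k _.
by rewrite conj_cquad -!scalemxAl -scalemxAr /conj_system !mulmxA.
Qed.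

Lemma conj_pscalar : pscalar conj_system = B *m pscalar P *m A.
Proof.
rewrite /pscalar; elim: (enum 'I_m) => [|k t IH] /=; first by rewrite mulmx1 BA.
by rewrite IH /conj_system -!mulmxA (mulmxA A B) AB mul1mx.
Qed.

End Conjugate.

Lemma pseudo_orthogonal_iso (R : realType) n s (A : 'M[R]_n) :
  pseudo_orthogonal s A -> forall u v, pinner s (A *m u) (A *m v) = pinner s u v.
Proof.
move=> hA u v; rewrite /pinner trmx_mul.
transitivity ((u^T *m (A^T *m Jmx R s n *m A) *m v) 0 0); last by rewrite hA.
by rewrite !mulmxA.
Qed.

Lemma pseudo_orthogonal_unit (R : realType) n s (A : 'M[R]_n) :
  pseudo_orthogonal s A -> A \in unitmx.
Proof.
move=> hA; have /mulmx1_unit[] // : (Jmx R s n *m A^T *m Jmx R s n) *m A = 1%:M.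
by rewrite -mulmxA -mulmxA (mulmxA A^T) hA mulJJ.
Qed.

Theorem theorem4p26 (R : realType) (l s m r : nat)
    (P : 'I_m -> 'M[R]_(2 * l)%N)
    (hl : (0 < l)%N) (hs : (s <= 2 * l - 1)%N) (hm : (1 < m)%N) (hr : (r <= m)%N)
    (hP : clifford_system s r P)
    (hm4 : m = 0 %[mod 4]) (hr2 : r = 0 %[mod 2]) (hlm : (m < l)%N)
    (c : R) (hc : W_RN s r P c) (hc1 : -1 < c)
    (L : set 'cV[R]_(2 * l)%N) (hL : is_component (level s r P c) L) :
  ~ homogeneous s L.
Proof.
move=> [H [[Horth H1 HM HV _] HL Htr]].
have m4 : (4 %| m)%N by rewrite /dvdn hm4 mod0n.
have r2 : ~~ odd r by rewrite -eqb0 -modn2 hr2.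
have m0 : (0 < m)%N by apply: ltnW.
have dim := clifford_dim hP m4 hlm.
have nm : (2 * m < 2 * l)%N by rewrite ltn_mul2l.
pose g0 : R := (1 - c) / 2.
have g00 : g0 != 0.
  apply/eqP => e; have [_] := hc; apply; right; rewrite /=; move: e; rewrite /g0; lra.
have g01 : g0 != 1.
  apply/eqP => e; have [_] := hc; apply; left; rewrite /=; move: e; rewrite /g0; lra.
have {}hL : is_component (unit_level s r P g0) L.
  rewrite (_ : unit_level s r P g0 = level s r P c) //; apply/seteqP.
  by split=> x [qx h]; split=> //; move: h; rewrite fkmFE [pinner s x x]qx expr1n /g0; lra.
have [x0 Lx0] : exists x, L x.
  by have [x Mx ->] := hL; exists x; apply: connected_component_refl.
pose f x : R := pinner s (pscalar P *m x) x.
have inv A : H A -> A *m invmx A = 1%:M /\ invmx A *m A = 1%:M.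
  by move=> /Horth /pseudo_orthogonal_unit Au; rewrite mulmxV // mulVmx.
have LA A : H A -> forall x, L x -> csum s r (conj_system P A (invmx A)) x = g0.
  move=> hA x Lx; have [AB _] := inv A hA.
  rewrite (conj_csum _ _ AB (pseudo_orthogonal_iso (Horth A hA))).
  by have [] := comp_level hL (HL A x hA Lx).
have nonflip_inv A x1 : H A -> L x1 -> cnormal s r P (A *m x1) = A *m cnormal s r P x1 ->
    forall x, f (A *m x) ^+ 2 = f x ^+ 2.
  move=> hA Lx1 nx1; have [AB BA] := inv A hA.
  have iso := pseudo_orthogonal_iso (Horth A hA).
  have hP' := conj_clifford hP AB BA iso.
  have n1 : cnormal s r (conj_system P A (invmx A)) x1 = cnormal s r P x1.
    by rewrite (conj_cnormal _ _ AB iso) nx1 mulmxA BA mul1mx.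
  have nL := normal_constant hP hP' g00 g01 hL (LA A hA) Lx1 n1.
  have cE := normal_csum hP hP' g00 g01 hL (LA A hA) Lx1 nL.
  have nm4 : (4 * m <= 2 * l + 4)%N by [].
  have sp := in_span_other m4 r2 hr m0 nm4 hP hP' (fun x => esym (cE x)).
  have sp' := in_span_other m4 r2 hr m0 nm4 hP' hP cE.
  have := pscalar_unique hP hP' m4 r2 hr m0 sp sp'.
  rewrite (conj_pscalar P AB BA) => h x.
  have -> : f (A *m x) = pinner s (invmx A *m pscalar P *m A *m x) x.
    by rewrite -!mulmxA (pinner_inv AB iso).
  by case: h => ->; rewrite ?mulNmx ?pinnerNl ?sqrrN.
have flip A x : H A -> L x -> cnormal s r P (A *m x) = A *m cnormal s r P x \/
    cnormal s r P (A *m x) = A *m ((2 * g0) *: x - cnormal s r P x).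
  move=> hA Lx; have [AB BA] := inv A hA.
  have iso := pseudo_orthogonal_iso (Horth A hA).
  have hP' := conj_clifford hP AB BA iso.
  have := normal_dichotomy hP hP' g00 g01 hL (LA A hA) Lx.
  rewrite (conj_cnormal _ _ AB iso); case=> <-; [left|right].
    by rewrite mulmxA AB mul1mx.
  by rewrite mulmxA AB mul1mx.
have cf : {in L, continuous f}.
  move=> x _; apply: cont_pinner; last exact: vcont_id.
  by apply: vcontM; exact: vcont_id.
(* All reflecting isometries differ from one of them, [A1], by a
   non-reflecting one. *)
have two : exists b, forall x, L x -> f x ^+ 2 = f x0 ^+ 2 \/ f x ^+ 2 = b.
  have [[A1 [hA1 fl1]]|no] := pselect (exists A, H A /\
      cnormal s r P (A *m x0) = A *m ((2 * g0) *: x0 - cnormal s r P x0)).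
    exists (f (A1 *m x0) ^+ 2) => x Lx; have [A hA <-] := Htr _ _ Lx0 Lx.
    have [nf|fl] := flip A x0 hA Lx0; first by left; apply: nonflip_inv nf _.
    right; have [_ BA1] := inv A1 hA1.
    have Ac : (A *m invmx A1) *m (A1 *m x0) = A *m x0.
      by rewrite -mulmxA (mulmxA _ A1) BA1 mul1mx.
    rewrite -Ac; apply: (nonflip_inv _ (A1 *m x0)); [exact/HM/HV | exact: HL |].
    by rewrite Ac fl fl1 -mulmxA (mulmxA _ A1) BA1 mul1mx.
  exists 0 => x Lx; have [A hA <-] := Htr _ _ Lx0 Lx.
  have [nf|fl] := flip A x0 hA Lx0; first by left; apply: nonflip_inv nf _.
  by case: no; exists A.
have [b fb] := two.
have cf2 : {in L, continuous (fun x => f x ^+ 2)}.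
  move=> x /cf cx; rewrite (_ : (fun _ => _) = (fun x => f x * f x)) //.
  exact: (cvgM cx cx).
have fsq := two_values (comp_connected hL) cf2 fb Lx0 erefl.
have fconst x : L x -> f x = f x0.
  apply: (two_values (b := - f x0) (comp_connected hL) cf _ Lx0 erefl) => y Ly.
  have /eqP := fsq y Ly.
  by rewrite eqf_sqr => /orP[/eqP h|/eqP h]; [left | right].
exact: (pscalar_nonconstant hP g00 g01 m4 m0 r2 hr nm hL Lx0 fconst).
Qed.
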